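(* Let $\Omega\subset\mathbb{R}^3$ be a bounded polyhedral domain with a conforming simplicial finite element mesh $\mathcal{T}$, and let $k\ge 4$ be even. Let $E\in\mathcal{E}$ be a critical edge and let $K\in\mathcal{T}_E$ be a tetrahedron which has $E$ as an edge. Let $\mathbf{w}_\ell\in\mathbb{R}^3$, $\ell=1,2,3$, be three linearly independent vectors. For $\mathbf{p}\in\mathcal{V}(E)$ let $p_{k-1}^{E,\mathbf{p}}$ be the critical pressure function associated with $E$ and $\mathbf{p}$ (defined in the context). Then any function $p\in\operatorname{span}\{p_{k-1}^{E,\mathbf{p}}:\mathbf{p}\in\mathcal{V}(E)\}$ which satisfies $$(p,\operatorname{div}\mathbf{v})_{L^2(\Omega)}=0\qquad\forall\,\mathbf{v}\in\operatorname{span}\{B_k^{\mathrm{CR},K}\mathbf{w}_\ell:1\le\ell\le 3\}$$ is the zero function.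
   Context: $\mathcal{T}$ consists of closed tetrahedra. $\mathcal{F}$ and $\mathcal{E}$ are the sets of all (two-dimensional) facets and (one-dimensional) edges of the mesh; $\mathcal{E}_{\partial\Omega}:=\{E\in\mathcal{E}: E\subset\partial\Omega\}$ (outer edges) and $\mathcal{E}_\Omega:=\mathcal{E}\setminus\mathcal{E}_{\partial\Omega}$ (inner edges). For $E\in\mathcal{E}$, $\mathcal{T}_E:=\{K\in\mathcal{T}:E\subset K\}$ and $\mathcal{V}(E)$ is the set of the two endpoints of $E$; $\mathcal{V}(K)$ is the set of the four vertices of $K$. For $\mathbf{z}\in\mathcal{V}(K)$, $\lambda_{K,\mathbf{z}}$ is the barycentric coordinate, i.e. the affine function on $K$ equal to $1$ at $\mathbf{z}$ and $0$ at the other vertices of $K$; $|K|$ is the volume of $K$ and $\chi_K$ its characteristic function. An edge $E\in\mathcal{E}$ is critical in $\mathcal{T}$ if all facets $F\in\mathcal{F}$ with $E\subset F$ lie in at most two flat planes. If a critical edge $E$ is inner, $\mathcal{T}_E$ consists of exactly four tetrahedra $K_1,\dots,K_4$, numbered cyclically ($K_5:=K_1$) so that $K_i$ and $K_{i+1}$ share a facet $F_i$, with $F_1,F_3$ lying in one plane and $F_2,F_4$ in one other plane. If a critical edge $E$ is outer, $\mathcal{T}_E=\{K_i:1\le i\le\iota_E\}$ with $\iota_E\in\{1,2,3\}$, numbered so that $K_i$ and $K_{i+1}$ share a facet. $P_n^{(\alpha,\beta)}$ denotes the Jacobi polynomial of degree $n$, orthogonal on $[-1,1]$ to all polynomials of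 degree less than $n$ with respect to the weight $(1-x)^\alpha(1+x)^\beta$, normalized by $P_n^{(\alpha,\beta)}(1)=(\alpha+1)_n/n!$ with $(a)_n=a(a+1)\cdots(a+n-1)$, $(a)_0=1$. For a critical edge $E$ and $\mathbf{p}\in\mathcal{V}(E)$, $$p_{k-1}^{E,\mathbf{p}}:=\sum_{i=1}^{\iota_E}\frac{(-1)^i}{|K_i|}\,\chi_{K_i}\,P_{k-1}^{(0,3)}(1-2\lambda_{K_i,\mathbf{p}}),$$ where $\iota_E=4$ if $E\in\mathcal{E}_\Omega$ and $\iota_E\in\{1,2,3\}$ if $E\in\mathcal{E}_{\partial\Omega}$. With $L_k=P_k^{(0,0)}$ the Legendre polynomials and $Q_k:=\frac{1}{k+1}(L_{k+1}-L_k)'$, for even $k$ the simplex-oriented Crouzeix-Raviart function is $$B_k^{\mathrm{CR},K}:=\Big(\sum_{\mathbf{z}\in\mathcal{V}(K)}Q_k(1-2\lambda_{K,\mathbf{z}})\Big)-1\ \text{ on }K,\qquad B_k^{\mathrm{CR},K}:=0\ \text{ otherwise.}$$ For such discontinuous piecewise polynomial $\mathbf{v}$, the divergence is taken elementwise: $(p,\operatorname{div}\mathbf{v})_{L^2(\Omega)}=\sum_{K'\in\mathcal{T}}\int_{K'}p\,\operatorname{div}\mathbf{v}$. *)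

(* Defs.v *)
From HB Require Import structures.
From mathcomp Require Import all_boot all_order all_algebra finmap.
From mathcomp Require Import all_classical all_reals all_analysis.
Import Order.TTheory GRing.Theory Num.Theory.
Import numFieldNormedType.Exports.

Set Implicit Arguments.
Unset Strict Implicit.
Unset Printing Implicit Defensive.

Local Open Scope classical_set_scope.
Local Open Scope ring_scope.

Notation pt R := 'rV[R]_3.

(* A simplex is represented by the finite set of its vertices; the closed
   simplex itself, as a subset of R^3, is [hull S]. *)
Notation simplex R := {fset pt R}.

Section Geometry.
Variable R : realType.

Definition hull (S : simplex R) : set (pt R) :=
  [set x | exists a : pt R -> R,
     [/\ forall z, z \in S -> 0 <= a z,
         \sum_(z <- S) a z = 1
       & x = \sum_(z <- S) a z *: z]].

Definition affinely_independent (S : simplex R) : Prop :=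
  forall a : pt R -> R,
    \sum_(z <- S) a z = 0 -> \sum_(z <- S) a z *: z = 0 ->
    forall z, z \in S -> a z = 0.

Definition is_tetrahedron (K : simplex R) : Prop :=
  #|` K| = 4%N /\ affinely_independent K.

Definition dot (x y : pt R) : R := (x *m y^T) 0 0.

Definition is_plane (P : set (pt R)) : Prop :=
  exists (n : pt R) (d : R), n != 0 /\ P = [set x | dot n x = d].

Definition boundary (A : set (pt R)) : set (pt R) := closure A `\` A°.

Definition bounded_polyhedral_domain (Omega : set (pt R)) : Prop :=
  [/\ Omega !=set0, connected Omega, bounded_set Omega
    & exists Ps : seq (simplex R),
        Omega = (\bigcup_(P in [set` Ps]) hull P)°].

(* In the last clause, [K `&` K'] is the set of common vertices: two elements
   meet in nothing, or in a common vertex, edge or facet, or they coincide. *)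
Definition conforming_mesh (Omega : set (pt R)) (T : {fset simplex R}) : Prop :=
  [/\ forall K, K \in T -> is_tetrahedron K,
      closure Omega = \bigcup_(K in [set` T]) hull K
    & forall K K', K \in T -> K' \in T ->
        hull K `&` hull K' = hull (K `&` K')%fset].

Definition is_facet (T : {fset simplex R}) (F : simplex R) : Prop :=
  #|` F| = 3%N /\ exists2 K, K \in T & (F `<=` K)%fset.

Definition is_edge (T : {fset simplex R}) (E : simplex R) : Prop :=
  #|` E| = 2%N /\ exists2 K, K \in T & (E `<=` K)%fset.

Definition outer_edge (Omega : set (pt R)) (E : simplex R) : Prop :=
  hull E `<=` boundary Omega.

Definition edge_patch (T : {fset simplex R}) (E : simplex R) :
    set (simplex R) :=
  [set K | K \in T /\ hull E `<=` hull K].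

Definition critical_edge (T : {fset simplex R}) (E : simplex R) : Prop :=
  is_edge T E /\
  exists P1 P2 : set (pt R),
    [/\ is_plane P1, is_plane P2
      & forall F, is_facet T F -> hull E `<=` hull F ->
          hull F `<=` P1 \/ hull F `<=` P2].

Definition shared_facet (T : {fset simplex R}) (K K' F : simplex R) : Prop :=
  [/\ is_facet T F, hull F `<=` hull K & hull F `<=` hull K'].

(* [Ks = [:: K_1; ...; K_iota]] is an admissible numbering of the patch of the
   critical edge [E]; the entry of index [i] is K_(i+1). *)
Definition patch_numbering (Omega : set (pt R)) (T : {fset simplex R})
    (E : simplex R) (Ks : seq (simplex R)) : Prop :=
  let K i := nth fset0 Ks i in
  [/\ uniq Ks,
      [set` Ks] = edge_patch T E,
      (outer_edge Omega E ->
         (1 <= size Ks <= 3)%N /\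
         forall i, (i.+1 < size Ks)%N ->
           exists F, shared_facet T (K i) (K i.+1) F)
    & (~ outer_edge Omega E ->
         size Ks = 4%N /\
         exists F1 F2 F3 F4 : simplex R,
           [/\ shared_facet T (K 0%N) (K 1%N) F1,
               shared_facet T (K 1%N) (K 2%N) F2,
               shared_facet T (K 2%N) (K 3%N) F3,
               shared_facet T (K 3%N) (K 0%N) F4
             & exists P P' : set (pt R),
                 [/\ is_plane P, is_plane P', P <> P',
                     hull F1 `<=` P /\ hull F3 `<=` P
                   & hull F2 `<=` P' /\ hull F4 `<=` P']])].

End Geometry.

Section Analysis.
Variable R : realType.

Definition is_affine (f : pt R -> R) : Prop :=
  exists (n : pt R) (d : R), forall x, f x = dot n x + d.

(* The barycentric coordinate of [K] at its vertex [z], extended affinely to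
   R^3; such an [f] exists and is unique when [K] is a tetrahedron. *)
Definition bary (K : simplex R) (z : pt R) : pt R -> R :=
  xget (cst 0) [set f : pt R -> R | is_affine f /\
                  forall y, y \in K -> f y = (y == z)%:R].

Local Notation mR := (measurableTypeR R).

Definition pt_of (x : mR * mR * mR) : pt R :=
  \row_(i < 3) [:: x.1.1; x.1.2; x.2]`_i.

Definition lebesgue3 : {measure set (mR * mR * mR) -> \bar R} :=
  ((@lebesgue_measure R \x @lebesgue_measure R) \x @lebesgue_measure R)%E.

Definition integral3 (A : set (pt R)) (f : pt R -> R) : R :=
  \int[lebesgue3]_(x in pt_of @^-1` A) f (pt_of x).

Definition volume (A : set (pt R)) : R := fine (lebesgue3 (pt_of @^-1` A)).

Definition divergence (v : pt R -> pt R) (x : pt R) : R :=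
  \sum_(i < 3) 'D_(delta_mx 0 i) (fun y => v y 0 i) x.

(* (p, div v)_{L^2(Omega)} with the elementwise divergence.  The integrals are
   over the open elements: the faces are null sets, and the derivatives of a
   piecewise polynomial [v] at an interior point of an element only involve the
   restriction of [v] to that element. *)
Definition pairing_div (T : {fset simplex R}) (p : pt R -> R)
    (v : pt R -> pt R) : R :=
  \sum_(K <- T) integral3 (hull K)° (fun x => p x * divergence v x).

Definition jacobi_weight (alpha beta : nat) (x : R) : R :=
  (1 - x) ^+ alpha * (1 + x) ^+ beta.

(* The normalization is (alpha+1)_n / n!. *)
Definition is_jacobi (n alpha beta : nat) (P : {poly R}) : Prop :=
  [/\ size P = n.+1,
      forall q : {poly R}, (size q <= n)%N ->
        \int[@lebesgue_measure R]_(x in `[-1, 1])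
           (jacobi_weight alpha beta x * P.[x] * q.[x]) = 0
    & P.[1] = (\prod_(j < n) (alpha.+1 + j)%:R) / n`!%:R].

Definition jacobi (n alpha beta : nat) : {poly R} :=
  xget 0 [set P | is_jacobi n alpha beta P].

Definition legendre (n : nat) : {poly R} := jacobi n 0 0.

Definition Qpoly (k : nat) : {poly R} :=
  (k.+1%:R)^-1 *: (legendre k.+1 - legendre k)^`().

Definition B_CR (k : nat) (K : simplex R) (x : pt R) : R :=
  \1_(hull K) x * ((\sum_(z <- K) (Qpoly k).[1 - 2 * bary K z x]) - 1).

(* The critical pressure p_{k-1}^{E,z}; the edge [E] only enters through the
   numbering [Ks] of its patch. *)
Definition critical_pressure (k : nat) (Ks : seq (simplex R)) (z : pt R)
    (x : pt R) : R :=
  \sum_(i < size Ks)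
    let K := nth fset0 Ks i in
    (-1) ^+ i.+1 / volume (hull K) * \1_(hull K) x *
      (jacobi k.-1 0 3).[1 - 2 * bary K z x].

Definition pressure_span (k : nat) (E : simplex R) (Ks : seq (simplex R)) :
    set (pt R -> R) :=
  [set p | exists c : pt R -> R,
     p = fun x => \sum_(z <- E) c z * critical_pressure k Ks z x].

Definition velocity_span (k : nat) (K : simplex R) (w : 3.-tuple (pt R)) :
    set (pt R -> pt R) :=
  [set v | exists c : 'I_3 -> R,
     v = fun x => \sum_(l < 3) c l *: (B_CR k K x *: tnth w l)].

End Analysis.

(* Main.v *)
Require Import Defs.
From HB Require Import structures.
From mathcomp Require Import all_boot all_order all_algebra finmap.
From mathcomp Require Import all_classical all_reals all_analysis.
From mathcomp Require Import measurable_realfun zify ring lra.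
Import Order.TTheory GRing.Theory Num.Theory.
Import numFieldNormedType.Exports.

(** On the interior of [K], the pressure [p] is a nonzero multiple of [c_z
    J(lambda_z) + c_q J(lambda_q)], where [z] and [q] are the endpoints of [E]
    and [J(lambda) = P_(k-1)^(0,3)(1 - 2 lambda)]: the other elements of the
    patch do not meet this interior. It suffices to show that [c_z = 0] for
    either endpoint.

    The given directions span the space, so the velocity [B_k^(CR,K) u] may be
    used with [u = z - r], for a vertex [r] of [K] outside [E]. Its divergence
    vanishes on the other elements, and on [K] it is [-2 (g(lambda_z) -
    g(lambda_r))] with [g(lambda) = Q_k'(1 - 2 lambda)]
    ([divergence_B_CR_in]). Integrals over [K] of products [f(lambda_a)
    h(lambda_b)] are, up to the factor [6 |K|], integrals over the standard
    simplex, hence do not depend on which two distinct vertices [a] and [b]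
    are used ([tetra_integral_vol]). So the terms in [c_q] cancel and the
    hypothesis becomes [c_z (A - B) = 0], where, up to this common factor, [A]
    is the integral of [J(lambda_z) g(lambda_z)] and [B] that of [J(lambda_z)
    g(lambda_r)].

    Integrating out the remaining coordinates turns [A] and [B] into integrals
    over [-1, 1] ([simplex_moment_bary_arg]). The orthogonality of the Jacobi
    and Legendre polynomials then leaves [A = W''(-1) M_2 / 16] and [B = W'(1)
    M_1 / 8], where [W' = Q_k] and [M_j] is the integral of [(1 + t)^j
    P_(k-1)^(0,3)(t)]. For even [k] one has [A > 0 > B]
    ([simplex_moment_gap]). The signs come from closed forms: the moments of
    an orthogonal polynomial are a rational function of their order whose
    zeros and poles are known, and its residues are the coefficients of the
    polynomial ([moment_num_orthogonal], [orthogonal_coef]).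

    The change of variables to the standard simplex rests on the fact that a
    translation-invariant measure is a multiple of Lebesgue measure
    ([translation_invariant_proportional]). *)

Set Implicit Arguments.
Unset Strict Implicit.
Unset Printing Implicit Defensive.

Local Open Scope classical_set_scope.
Local Open Scope ring_scope.

(** * Translation-invariant measures on the space of triples *)

Notation mR R := (measurableTypeR R).
Notation triple R := (mR R * mR R * mR R)%type.

(** The product measure as a sigma-finite measure, so that products can be
    iterated and Tonelli applied to them. *)
Section ProductSigmaFinite.
Context d1 d2 (T1 : measurableType d1) (T2 : measurableType d2) (R : realType).
Variables (m1 : {sigma_finite_measure set T1 -> \bar R})
  (m2 : {sigma_finite_measure set T2 -> \bar R}).

Definition sigma_finite_prod : set (T1 * T2) -> \bar R := (m1 \x m2)%E.

HB.instance Definition _ := Measure.copy sigma_finite_prod (m1 \x m2)%E.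

Let sigma_finite_prodT : sigma_finite setT sigma_finite_prod.
Proof.
have [] := lebesgue_integral_fubini.measure_function_Measure_isSigmaFinite__to__measure_function_isSigmaFinite
  m1 m2.
by [].
Qed.

HB.instance Definition _ :=
  Measure_isSigmaFinite.Build _ _ _ sigma_finite_prod sigma_finite_prodT.

End ProductSigmaFinite.

Definition leb1 (R : realType) : {sigma_finite_measure set (mR R) -> \bar R} :=
  @lebesgue_measure R.
Definition area (R : realType) :
    {sigma_finite_measure set (mR R * mR R)%type -> \bar R} :=
  sigma_finite_prod (leb1 R) (leb1 R).
Definition leb3 (R : realType) :
    {sigma_finite_measure set (triple R) -> \bar R} :=
  sigma_finite_prod (area R) (leb1 R).

Lemma lebesgue_measure_translation (R : realType) (v : R) (A : set (mR R)) :
  measurable A ->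
  lebesgue_measure ((fun x : mR R => v + x : mR R) @^-1` A) = lebesgue_measure A.
Proof.
move=> mA.
have mt : measurable_fun setT (fun x : mR R => v + x : mR R).
  by apply: measurable_funD => //; exact: measurable_cst.
pose phi x : mR R := v + x.
have := @lebesgue_measure_unique R (pushforward lebesgue_measure phi).
move=> /(_ mt)/= H; symmetry; apply: H mA => _ [[a b]] _ <-.
rewrite /pushforward /=.
have -> : (fun x : mR R => v + x : mR R) @^-1` `]a, b]%classic =
    `](a - v), (b - v)]%classic.
  by apply/seteqP; split => x /=; rewrite !in_itv/= ltrBlDl lerBrDl.
rewrite !lebesgue_measure_itv/= !lte_fin ltrD2r.
by case: ifP => // _; rewrite -!EFinB; congr EFin; rewrite opprB addrA subrK.
Qed.

Lemma measurable_preimage d d' (T : measurableType d) (T' : measurableType d')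
    (f : T -> T') (A : set T') :
  measurable_fun setT f -> measurable A -> measurable (f @^-1` A).
Proof. by move=> mf mA; rewrite -[X in measurable X]setTI; exact: mf. Qed.

Lemma product_measure_preserved d1 d2 (T1 : measurableType d1)
    (T2 : measurableType d2) (R : realType)
    (m1 : {sigma_finite_measure set T1 -> \bar R})
    (m2 : {sigma_finite_measure set T2 -> \bar R})
    (phi1 : T1 -> T1) (phi2 : T2 -> T2) :
  measurable_fun setT phi1 -> measurable_fun setT phi2 ->
  (forall A, measurable A -> m1 (phi1 @^-1` A) = m1 A) ->
  (forall A, measurable A -> m2 (phi2 @^-1` A) = m2 A) ->
  forall A, measurable A ->
  (m1 \x m2)%E ((fun x => (phi1 x.1, phi2 x.2)) @^-1` A) = (m1 \x m2)%E A.
Proof.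
move=> mp1 mp2 p1 p2 A mA.
have mp : measurable_fun setT (fun x : T1 * T2 => (phi1 x.1, phi2 x.2)).
  apply: measurable_fun_pair => /=.
    exact: (measurableT_comp mp1).
  exact: (measurableT_comp mp2).
pose phi x : T1 * T2 := (phi1 x.1, phi2 x.2).
have := @product_measure_unique _ _ _ _ _ m1 m2 (pushforward (m1 \x m2)%E phi).
move=> /(_ mp)/= H; symmetry; apply: H mA => B C mB mC.
rewrite /pushforward/=.
have -> : (fun x : T1 * T2 => (phi1 x.1, phi2 x.2)) @^-1` (B `*` C) =
          (phi1 @^-1` B) `*` (phi2 @^-1` C) by [].
have mB' : measurable (phi1 @^-1` B) by exact: measurable_preimage.
have mC' : measurable (phi2 @^-1` C) by exact: measurable_preimage.
rewrite -(p1 _ mB) -(p2 _ mC); exact: product_measure1E.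
Qed.

Definition add3 (R : realType) (v x : triple R) : triple R :=
  (v.1.1 + x.1.1, v.1.2 + x.1.2, v.2 + x.2).

Definition opp3 (R : realType) (x : triple R) : triple R :=
  (- x.1.1, - x.1.2, - x.2).

Lemma add3C (R : realType) (x y : triple R) : add3 x y = add3 y x.
Proof. by rewrite /add3 addrC [y.1.2 + _]addrC [y.2 + _]addrC. Qed.

Lemma add3K (R : realType) (x y : triple R) : add3 (opp3 x) (add3 x y) = y.
Proof. by case: y => [[? ?] ?]; rewrite /add3/= !addKr. Qed.

Lemma add3NK (R : realType) (x y : triple R) :
  add3 (opp3 (add3 x y)) x = opp3 y.
Proof. by rewrite /add3/opp3/=; congr (_, _, _); rewrite opprD addrAC addNr add0r. Qed.

Lemma measurable_fst3 (R : realType) : measurable_fun setT (fun x : triple R => x.1.1).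
Proof. exact: measurableT_comp. Qed.
Lemma measurable_snd3 (R : realType) : measurable_fun setT (fun x : triple R => x.1.2).
Proof. exact: measurableT_comp. Qed.

Lemma leb3_translation (R : realType) (v : triple R) (A : set (triple R)) :
  measurable A -> leb3 R (add3 v @^-1` A) = leb3 R A.
Proof.
have mt w : measurable_fun setT (fun x : mR R => w + x : mR R).
  by apply: measurable_funD => //; exact: measurable_cst.
pose phi2 (x : mR R * mR R) : mR R * mR R := (v.1.1 + x.1, v.1.2 + x.2).
have mphi2 : measurable_fun setT phi2.
  by apply: measurable_fun_pair => /=; apply: (measurableT_comp (mt _)).
have tr2 B : measurable B -> area R (phi2 @^-1` B) = area R B.
  exact: (product_measure_preserved (m1 := leb1 R) (m2 := leb1 R)
    (mt v.1.1) (mt v.1.2) (lebesgue_measure_translation v.1.1)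
    (lebesgue_measure_translation v.1.2)).
exact: (product_measure_preserved (m1 := area R) (m2 := leb1 R)
  mphi2 (mt v.2) tr2 (lebesgue_measure_translation v.2)).
Qed.

Lemma measurable_add3 (R : realType) d (T : measurableType d) (f g : T -> triple R) :
  measurable_fun setT f -> measurable_fun setT g ->
  measurable_fun setT (fun x => add3 (f x) (g x)).
Proof.
move=> mf mg; apply: measurable_fun_pair; first apply: measurable_fun_pair.
- apply: (measurable_funD (f := fun t => (f t).1.1) (g := fun t => (g t).1.1)).
    exact: (measurableT_comp (@measurable_fst3 R) mf).
  exact: (measurableT_comp (@measurable_fst3 R) mg).
- apply: (measurable_funD (f := fun t => (f t).1.2) (g := fun t => (g t).1.2)).
    exact: (measurableT_comp (@measurable_snd3 R) mf).
  exact: (measurableT_comp (@measurable_snd3 R) mg).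
- apply: (measurable_funD (f := fun t => (f t).2) (g := fun t => (g t).2)).
    exact: (measurableT_comp measurable_snd mf).
  exact: (measurableT_comp measurable_snd mg).
Qed.

Lemma measurable_opp3 (R : realType) d (T : measurableType d) (f : T -> triple R) :
  measurable_fun setT f -> measurable_fun setT (fun x => opp3 (f x)).
Proof.
move=> mf; apply: measurable_fun_pair; first apply: measurable_fun_pair.
- apply: (measurable_funN (f := fun t => (f t).1.1)).
  exact: (measurableT_comp (@measurable_fst3 R) mf).
- apply: (measurable_funN (f := fun t => (f t).1.2)).
  exact: (measurableT_comp (@measurable_snd3 R) mf).
- apply: (measurable_funN (f := fun t => (f t).2)).
  exact: (measurableT_comp measurable_snd mf).
Qed.

(** Tonelli's theorem compares the [mu \x nu]-measures of [S = {(x, y) | x + y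
    in A, y in B}] and [S' = {(x, y) | y in A, y - x in B}]. At fixed [x]
    their sections are translates of each other, so the two sets have the same
    measure. At fixed [y] the sections are translates of [A] and of [- B],
    which gives the two sides. With [B] fixed, [mu] is therefore a multiple of
    [nu]. *)
Lemma translation_invariant_proportional (R : realType)
    (mu nu : {sigma_finite_measure set (triple R) -> \bar R}) :
  (forall v A, measurable A -> mu (add3 v @^-1` A) = mu A) ->
  (forall v A, measurable A -> nu (add3 v @^-1` A) = nu A) ->
  forall A B, measurable A -> measurable B ->
  (mu A * nu B = nu A * mu (@opp3 R @^-1` B))%E.
Proof.
move=> muT nuT A B mA mB.
pose S : set (triple R * triple R) := [set z | A (add3 z.1 z.2) /\ B z.2].
pose S' : set (triple R * triple R) := [set z | A z.2 /\ B (add3 (opp3 z.1) z.2)].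
have mS : measurable S.
  apply: measurableI; apply: measurable_preimage => //; exact: measurable_add3.
have mS' : measurable S'.
  apply: measurableI; apply: measurable_preimage => //; apply: measurable_add3 => //.
  exact: measurable_opp3.
have e1 : (mu \x nu)%E S = (mu \x nu)%E S'.
  apply: eq_integral => x _ /=.
  rewrite -[RHS](nuT x); last exact: measurable_xsection.
  congr (nu _); apply/seteqP; split => y /=;
    rewrite /xsection/= !inE /S /S' /= add3K //.
have swap X : measurable X -> (mu \x nu)%E X = (mu \x^ nu)%E X.
  by apply: product_measure_unique => *; exact: product_measure2E.
move: e1; rewrite !swap// /product_measure2.
have -> : (mu \o ysection S = fun y => (\1_B y)%:E * mu A)%E.
  apply/funext => y /=; rewrite indicE; have [yB|yB] := boolP (y \in B).
    rewrite mul1e -(muT y A mA); congr (mu _).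
    apply/seteqP; split => x /=; rewrite /ysection/= !inE /S/= add3C; first by case.
    by move=> ?; split => //; rewrite inE in yB.
  rewrite mul0e (_ : ysection S y = set0) ?measure0//.
  apply/seteqP; split => x //=; rewrite /ysection/= inE /S/= => -[_].
  by rewrite notin_setE in yB.
have -> : (mu \o ysection S' = fun y => (\1_A y)%:E * mu (@opp3 R @^-1` B))%E.
  apply/funext => y /=; rewrite indicE; have [yA|yA] := boolP (y \in A).
    rewrite mul1e.
    rewrite -(muT y); last exact: measurable_ysection.
    congr (mu _); apply/seteqP; split => x /=; rewrite /ysection/= !inE /S'/= add3NK.
      by case.
    by move=> ?; split => //; rewrite inE in yA.
  rewrite mul0e (_ : ysection S' y = set0) ?measure0//.
  apply/seteqP; split => x //=; rewrite /ysection/= inE /S'/= => -[].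
  by rewrite notin_setE in yA.
rewrite !ge0_integralZr//; [|exact: measurableT_comp..].
by rewrite !integral_indic// !setIT muleC.
Qed.

(** * Affine images of Lebesgue measure *)

Definition cube (R : realType) : set (triple R) :=
  let I : set (mR R) := `[0, 1]%classic in (I `*` I) `*` I.

Lemma measurable_cube (R : realType) : measurable (@cube R).
Proof. by apply: measurableX => //; exact: measurableX. Qed.

Lemma leb1_itv01 (R : realType) : leb1 R `[0, 1]%classic = 1%E.
Proof.
by rewrite /leb1 /= lebesgue_measure_itv/= lte_fin ltr01 -EFinB subr0.
Qed.

Lemma leb3_cube (R : realType) : leb3 R (@cube R) = 1%E.
Proof.
pose I : set (mR R) := `[0, 1]%classic.
have mI : measurable I by exact: measurable_itv.
have e2 : area R (I `*` I) = 1%E.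
  have -> : area R (I `*` I) = (leb1 R I * leb1 R I)%E by exact: product_measure1E.
  by rewrite leb1_itv01 mule1.
have -> : leb3 R (@cube R) = (area R (I `*` I) * leb1 R I)%E.
  by apply: product_measure1E => //; exact: measurableX.
by rewrite e2 leb1_itv01 mule1.
Qed.

(** The image of Lebesgue measure under [L] is again translation invariant,
    hence proportional to it. No determinant is computed: only the positivity
    and finiteness of the factor matter, and both follow from evaluating at
    the image of the unit cube. *)
Lemma affine_pushforward (R : realType) (L M : triple R -> triple R) :
  measurable_fun setT L -> measurable_fun setT M -> cancel L M -> cancel M L ->
  (forall v, exists u, forall x, L (add3 u x) = add3 v (L x)) ->
  exists2 c : R, 0 < c &
    forall A, measurable A -> (leb3 R (L @^-1` A) = c%:E * leb3 R A)%E.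
Proof.
move=> mL mM LM ML LT.
have sL : sigma_finite setT (pushforward (leb3 R) L).
  have [F [TF Foo]] := sigma_finiteT (leb3 R).
  exists (fun n => M @^-1` F n).
    by rewrite -preimage_bigcup -TF preimage_setT.
  move=> n; have [mF Fn] := Foo n; split; first exact: measurable_preimage.
  rewrite /pushforward -comp_preimage (_ : M \o L = id) ?preimage_id//.
  by apply/funext => x; exact: LM.
pose mu0 : {measure set triple R -> \bar R} :=
  measure_function_pushforward__canonical__measure_function_Measure (leb3 R) mL.
pose H1 := isSFinite.Build _ _ _ mu0 (sfinite_measure_sigma_finite sL).
pose H2 := isSigmaFinite.Build _ _ _ mu0 sL.
pose mu := HB.pack_for {sigma_finite_measure set triple R -> \bar R}
  (Measure.sort mu0) H1 H2.
have muE A : mu A = leb3 R (L @^-1` A) by [].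
have muT v A : measurable A -> mu (add3 v @^-1` A) = mu A.
  move=> mA; have [u Lu] := LT v; rewrite !muE.
  have mLA : measurable (L @^-1` A) by exact: measurable_preimage.
  rewrite -(leb3_translation u mLA).
  have -> : L @^-1` (add3 v @^-1` A) = add3 u @^-1` (L @^-1` A).
    by apply/funext => x; rewrite /preimage /= Lu.
  by [].
have muC A : measurable A -> (mu A = leb3 R A * mu (@opp3 R @^-1` @cube R))%E.
  move=> mA; rewrite -(translation_invariant_proportional muT (@leb3_translation R) mA
    (@measurable_cube R)).
  by rewrite leb3_cube mule1.
have mMc : measurable (M @^-1` @cube R).
  exact: (measurable_preimage mM (@measurable_cube R)).
have := muC _ mMc.
have {1}-> : mu (M @^-1` @cube R) = 1%E.
  rewrite muE -(leb3_cube R); congr (leb3 R _).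
  by apply/funext => x; rewrite /preimage /= LM.
move: muC; have : (0 <= mu (@opp3 R @^-1` @cube R))%E by exact: measure_ge0.
have : (0 <= leb3 R (M @^-1` @cube R))%E by exact: measure_ge0.
move: (mu (@opp3 R @^-1` @cube R)) (leb3 R (M @^-1` @cube R)) => c a a0 c0 muC.
case: c c0 muC => [c|_|//]; last first.
  move=> _ e; move: a0; rewrite le_eqVlt => /orP[/eqP a0|a0].
    by move: e; rewrite -a0 mul0e => /eqP; rewrite onee_eq0.
  by move: e; rewrite gt0_muley.
rewrite lee_fin => c0 muC e.
exists c; last by move=> A mA; rewrite -muE muC// muleC.
rewrite lt_neqAle c0 andbT; apply/eqP => c00.
by move: e; rewrite -c00 mule0 => /eqP; rewrite onee_eq0.
Qed.

(** * Integrals of polynomials over intervals *)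

(** The antiderivative that vanishes at 0; the coefficient of index 0 is [p`_0
    / 0 = 0]. *)
Definition prim (R : realType) (p : {poly R}) : {poly R} :=
  \poly_(i < (size p).+1) (p`_i.-1 / i%:R).

Lemma coef_prim (R : realType) (p : {poly R}) i : (prim p)`_i = p`_i.-1 / i%:R.
Proof.
rewrite coef_poly; case: ltnP => // pi.
case: i pi => [//|i] /= pi.
by rewrite nth_default ?mul0r//.
Qed.

Lemma deriv_prim (R : realType) (p : {poly R}) : (prim p)^`() = p.
Proof.
apply/polyP => i; rewrite coef_deriv coef_prim /= -[LHS]mulr_natr divfK//.
Qed.

Lemma prim0 (R : realType) (p : {poly R}) : (prim p).[0] = 0.
Proof. by rewrite horner_coef0 coef_prim invr0 mulr0. Qed.

Lemma deriv_eq0 (R : realType) (p : {poly R}) : p^`() = 0 -> p = (p`_0)%:P.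
Proof.
move=> /polyP p0; apply/polyP => -[|i]; rewrite coefC//=.
have := p0 i; rewrite coef_deriv coef0 => /eqP.
by rewrite mulrn_eq0/= => /eqP.
Qed.

Definition pint (R : realType) (a b : R) (p : {poly R}) : R :=
  (prim p).[b] - (prim p).[a].

Lemma pint_deriv (R : realType) (a b : R) (p : {poly R}) :
  pint a b p^`() = p.[b] - p.[a].
Proof.
have : (prim p^`() - p)^`() = 0 by rewrite derivB deriv_prim subrr.
move=> /deriv_eq0; set c := _`_0 => /eqP; rewrite subr_eq => /eqP pE.
by rewrite /pint pE !hornerE opprD addrACA subrr add0r.
Qed.

Lemma prim_is_linear (R : realType) : linear (@prim R).
Proof.
move=> c p q; apply/polyP => i.
by rewrite coefD coefZ !coef_prim coefD coefZ mulrDl mulrA.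
Qed.
HB.instance Definition _ (R : realType) :=
  GRing.isLinear.Build R {poly R} {poly R} _ (@prim R) (@prim_is_linear R).

Lemma pint_is_scalar (R : realType) (a b : R) : scalar (pint a b).
Proof. by move=> c p q; rewrite /pint linearP/= !(hornerD, hornerZ); ring. Qed.
HB.instance Definition _ (R : realType) (a b : R) :=
  GRing.isLinear.Build R {poly R} R _ (pint a b) (@pint_is_scalar R a b).

Lemma continuous_horner (R : realType) (p : {poly R}) : continuous (horner p).
Proof.
move=> x; apply: differentiable_continuous; apply/derivable1_diffP.
exact: derivable_horner.
Qed.

Lemma integral_poly_itv (R : realType) (a b : R) (p : {poly R}) : a <= b ->
  (\int[lebesgue_measure]_(x in `[a, b]) (p.[x])%:E = (pint a b p)%:E)%E.
Proof.
rewrite le_eqVlt => /orP[/eqP<-|ab].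
  by rewrite set_itv1 integral_set1 /pint subrr.
rewrite (@continuous_FTC2 _ (horner p) (horner (prim p)))//.
- apply: continuous_subspaceT; exact: continuous_horner.
- split.
  + by move=> x _; exact: derivable_horner.
  + by apply: cvg_at_right_filter; exact: continuous_horner.
  + by apply: cvg_at_left_filter; exact: continuous_horner.
- by move=> x _; rewrite -derivE deriv_prim.
Qed.

Lemma integral_poly_itv_oo (R : realType) (a b : R) (p : {poly R}) : a <= b ->
  (\int[lebesgue_measure]_(x in `]a, b[) (p.[x])%:E = (pint a b p)%:E)%E.
Proof.
move=> ab; rewrite -integral_poly_itv//.
rewrite [RHS]integral_itv_bndoo//; apply/measurable_EFinP.
apply: measurable_funTS; apply: continuous_measurable_fun.
exact: continuous_horner.
Qed.

(** The weight [m - 'X] is the length of a slice of the triangle with legs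
    [m]; integrating against it amounts to integrating twice. *)
Lemma pint_cone (R : realType) (g : {poly R}) (m : R) :
  pint 0 m (g * (m%:P - 'X)) = (prim (prim g)).[m].
Proof.
have -> : g * (m%:P - 'X) = (prim g * (m%:P - 'X) + prim (prim g))^`().
  by rewrite derivD derivM !deriv_prim derivB derivC derivX; ring.
by rewrite pint_deriv !hornerE !prim0; ring.
Qed.

Lemma pint_scale (R : realType) (a b c d : R) (p : {poly R}) : c != 0 ->
  pint a b (p \Po (c *: 'X + d%:P)) = c^-1 * pint (c * a + d) (c * b + d) p.
Proof.
move=> c0.
have -> : p \Po (c *: 'X + d%:P) =
    (c^-1 *: (prim p \Po (c *: 'X + d%:P)))^`().
  rewrite derivZ deriv_comp deriv_prim derivD derivZ derivX derivC addr0.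
  by rewrite -scalerAr mulr1 scalerA mulVf// scale1r.
by rewrite pint_deriv /pint !hornerE !horner_comp !hornerE; ring.
Qed.

(** * Moments of the standard simplex *)

Lemma measurable_horner (R : realType) d (T : measurableType d) (D : set T)
    (f : T -> R) (p : {poly R}) :
  measurable_fun D f -> measurable_fun D (fun x => p.[f x]).
Proof.
move=> mf; apply: (measurableT_comp (f := horner p)) => //.
by apply: continuous_measurable_fun; exact: continuous_horner.
Qed.

Lemma horner_bounded01 (R : realType) (p : {poly R}) :
  exists2 M, 0 <= M & forall x, 0 <= x <= 1 -> `|p.[x]| <= M.
Proof.
elim/poly_ind: p => [|p c [M M0 IH]].
  by exists 0 => // x _; rewrite horner0 normr0.
exists (M + `|c|); first by rewrite addr_ge0.
move=> x /[dup] x01 /andP[x0 x1]; rewrite !hornerE.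
rewrite (le_trans (ler_normD _ _))// lerD2r normrM.
by rewrite -[leRHS]mulr1 ler_pM// ?IH// ger0_norm.
Qed.

(** Fubini's theorem over a subset of the product, the form suited to slicing
    a simplex. *)
Lemma integral_sections d1 d2 (T1 : measurableType d1) (T2 : measurableType d2)
    (R : realType) (m1 : {sigma_finite_measure set T1 -> \bar R})
    (m2 : {sigma_finite_measure set T2 -> \bar R}) (D : set (T1 * T2))
    (f : T1 * T2 -> R) :
  measurable D -> (m1 \x m2)%E.-integrable D (EFin \o f) ->
  (\int[m1 \x m2]_(z in D) (f z)%:E =
   \int[m1]_x \int[m2]_(y in [set y | D (x, y)]) (f (x, y))%:E)%E.
Proof.
move=> mD fi; rewrite integral_mkcond.
have fi' : (m1 \x m2)%E.-integrable setT ((EFin \o f) \_ D).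
  by apply/(integrable_mkcond _ mD).
rewrite -(@integral12_prod_meas1 _ _ _ _ _ m1 m2)//.
apply: eq_integral => x _; rewrite /fubini_F [RHS]integral_mkcond.
apply: eq_integral => y _; rewrite /patch.
have -> : (y \in [set y0 | D (x, y0)]) = ((x, y) \in D); last by [].
by apply/idP/idP; rewrite !inE.
Qed.

Definition triangle (R : realType) : set (mR R * mR R)%type :=
  [set x | [/\ 0 < x.1, 0 < x.2 & x.1 + x.2 < 1]].

Definition simplex3 (R : realType) : set (triple R) :=
  [set x | [/\ 0 < x.1.1, 0 < x.1.2, 0 < x.2 & x.1.1 + x.1.2 + x.2 < 1]].

Lemma measurable_lt0 d (T : measurableType d) (R : realType) (f g : T -> R) :
  measurable_fun setT f -> measurable_fun setT g -> measurable [set x | f x < g x].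
Proof.
move=> mf mg.
have := measurable_fun_ltr mf mg measurableT (Y := [set true]).
rewrite setTI; apply => //.
Qed.

Lemma measurable_triangle (R : realType) : measurable (@triangle R).
Proof.
have -> : @triangle R = [set x | 0 < x.1] `&` [set x | 0 < x.2] `&`
    [set x | x.1 + x.2 < 1].
  by apply/seteqP; split => x /=; rewrite /triangle /=; [case|case=> -[]].
apply: measurableI; first apply: measurableI.
- exact: measurable_lt0.
- exact: measurable_lt0.
- apply: measurable_lt0 => //.
  exact: (measurable_funD (f := fst) (g := snd)).
Qed.

Lemma measurable_simplex3 (R : realType) : measurable (@simplex3 R).
Proof.
have -> : @simplex3 R = [set x | 0 < x.1.1] `&` [set x | 0 < x.1.2] `&`
    [set x | 0 < x.2] `&` [set x | x.1.1 + x.1.2 + x.2 < 1].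
  apply/seteqP; split => x /=; rewrite /simplex3 /=; first by case.
  by case=> -[][].
have m1 := @measurable_fst3 R; have m2 := @measurable_snd3 R.
apply: measurableI; first apply: measurableI; first apply: measurableI.
- exact: measurable_lt0.
- exact: measurable_lt0.
- exact: measurable_lt0.
- apply: measurable_lt0 => //.
  apply: (measurable_funD (f := fun x : triple R => x.1.1 + x.1.2 : R)
    (g := fun x : triple R => x.2 : R)) => //; last exact: measurable_snd.
  exact: (measurable_funD (f := fun x : triple R => x.1.1 : R)
    (g := fun x : triple R => x.1.2 : R)).
Qed.

Lemma integrable_simplex3 (R : realType) (f g : {poly R}) :
  (leb3 R).-integrable (@simplex3 R) (fun x => (f.[x.1.1] * g.[x.1.2])%:E).
Proof.
have mS := @measurable_simplex3 R.
apply: (@measurable_bounded_integrable _ _ _ (leb3 R)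
  (fun x : triple R => f.[x.1.1] * g.[x.1.2])) => //.
- apply: (@le_lt_trans _ _ (leb3 R (@cube R))); last by rewrite leb3_cube ltry.
  apply: le_measure; rewrite ?inE//; first exact: measurable_cube.
  move=> [[a b] c] [/= a0 b0 c0 abc]; rewrite /cube/= /setX/= !in_itv/=.
  have := ltW; split; first split; apply/andP; split; lra.
- apply: measurable_funM.
    apply: measurable_horner; apply: measurable_funTS; exact: measurable_fst3.
  apply: measurable_horner; apply: measurable_funTS; exact: measurable_snd3.
- have [M M0 Mf] := horner_bounded01 f; have [N N0 Ng] := horner_bounded01 g.
  exists (M * N); split; first exact: num_real.
  move=> C MNC [[a b] c] [/= a0 b0 c0 abc]; apply/ltW/(le_lt_trans _ MNC).
  rewrite normrM ler_pM// ?Mf ?Ng//; apply/andP; split; lra.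
Qed.

Lemma integrable_triangle (R : realType) (f g h : {poly R}) :
  (area R).-integrable (@triangle R)
    (fun x => (f.[x.1] * (g.[x.2] * h.[1 - x.1 - x.2]))%:E).
Proof.
have mS := @measurable_triangle R.
apply: (@measurable_bounded_integrable _ _ _ (area R)
  (fun x : (mR R * mR R)%type => f.[x.1] * (g.[x.2] * h.[1 - x.1 - x.2]))) => //.
- pose I : set (mR R) := `[0, 1]%classic.
  have mI : measurable I by exact: measurable_itv.
  have e2 : area R (I `*` I) = (leb1 R I * leb1 R I)%E by exact: product_measure1E.
  apply: (@le_lt_trans _ _ (area R (I `*` I))); last first.
    by rewrite e2 leb1_itv01 mule1 ltry.
  apply: le_measure; rewrite ?inE//; first exact: measurableX.
  move=> [a b] [/= a0 b0 abc]; rewrite /setX/= /I/= !in_itv/=.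
  split; apply/andP; split; lra.
- have m1 : measurable_fun (@triangle R) (fun x => x.1 : R)
    by apply: measurable_funTS; exact: measurable_fst.
  have m2 : measurable_fun (@triangle R) (fun x => x.2 : R)
    by apply: measurable_funTS; exact: measurable_snd.
  apply: measurable_funM; first exact: measurable_horner.
  apply: measurable_funM; first exact: measurable_horner.
  apply: measurable_horner; apply: measurable_funB => //.
  by apply: measurable_funB => //; exact: measurable_cst.
- have [M M0 Mf] := horner_bounded01 f; have [N N0 Ng] := horner_bounded01 g.
  have [P P0 Ph] := horner_bounded01 h.
  exists (M * (N * P)); split; first exact: num_real.
  move=> C MNC [a b] [/= a0 b0 abc]; apply/ltW/(le_lt_trans _ MNC).
  rewrite !normrM ler_pM ?Mf ?mulr_ge0//; first by apply/andP; split; lra.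
  by rewrite ler_pM// ?Ng ?Ph//; apply/andP; split; lra.
Qed.

Lemma integrable_poly_oo (R : realType) (a b : R) (p : {poly R}) :
  (leb1 R).-integrable `]a, b[%classic (fun x => (p.[x])%:E).
Proof.
have h : (leb1 R).-integrable `[a, b]%classic (fun x => (p.[x])%:E).
  apply: (continuous_compact_integrable (f := horner p)).
    exact: segment_compact.
  by apply: continuous_subspaceT; exact: continuous_horner.
apply: (integrableS _ _ _ h); [exact: measurable_itv|exact: measurable_itv|].
exact: subset_itv_oo_cc.
Qed.

(** The integral of [f(a) g(b)] over the standard simplex, after the other two
    variables have been integrated out. *)
Definition simplex_moment (R : realType) (f g : {poly R}) : R :=
  pint 0 1 (f * (prim (prim g) \Po (1 - 'X))).

(** The factor [1 - a - b] is the length of the slice of [simplex3] over the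
    point [(a, b)]. *)
Lemma integral_triangle (R : realType) (f g : {poly R}) :
  (\int[area R]_(x in @triangle R) (f.[x.1] * (g.[x.2] * (1 - x.1 - x.2)))%:E
   = (simplex_moment f g)%:E)%E.
Proof.
have mS := @measurable_triangle R.
have fi := integrable_triangle f g 'X.
under eq_integral do rewrite -[X in _ * (_ * X)]hornerX.
rewrite /area (integral_sections (m1 := leb1 R) (m2 := leb1 R))//.
rewrite /simplex_moment -integral_poly_itv_oo// [RHS]integral_mkcond.
apply: eq_integral => a' _; have [a aE] : exists a : R, a = a' by exists a'.
rewrite -{a'}aE /patch mem_setE in_itv/=.
under eq_integral do rewrite hornerX.
have [/andP[a0 a1]|a01] := boolP (0 < a < 1).
  have -> : [set y | @triangle R (a, y)] = `]0, (1 - a)[%classic.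
    apply/seteqP; split => b /=; rewrite /triangle/= in_itv/=.
      by case=> _ b0 b1; apply/andP; split => //; lra.
    by move=> /andP[b0 b1]; split => //; lra.
  pose q : {poly R} := g * ((1 - a)%:P - 'X).
  transitivity (\int[leb1 R]_(y in `]0%R, (1 - a)%R[) ((f.[a])%:E * (q.[y])%:E))%E.
    by apply: eq_integral => b _; rewrite -EFinM /q !hornerE.
  rewrite integralZl//; last exact: integrable_poly_oo.
  rewrite /leb1/= integral_poly_itv_oo; last lra.
  by rewrite pint_cone -EFinM; congr EFin; rewrite !(hornerE, horner_comp).
have -> : [set y | @triangle R (a, y)] = set0.
  apply/seteqP; split => b //= [/= a0 b0 ab].
  by move: a01; rewrite a0/= -leNgt => a1; lra.
by rewrite integral_set0.
Qed.

Lemma integral_simplex3 (R : realType) (f g : {poly R}) :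
  (\int[leb3 R]_(x in @simplex3 R) (f.[x.1.1] * g.[x.1.2])%:E =
   (simplex_moment f g)%:E)%E.
Proof.
have mS := @measurable_simplex3 R.
have fi := integrable_simplex3 f g.
rewrite /leb3 (integral_sections (m1 := area R) (m2 := leb1 R))//.
rewrite -integral_triangle [RHS]integral_mkcond.
apply: eq_integral => -[a' b'] _ /=.
have [a aE] : exists a : R, a = a' by exists a'.
have [b bE] : exists b : R, b = b' by exists b'.
rewrite -{a'}aE -{b'}bE /patch.
have [/set_mem[/= a0 b0 ab]|/negP ab] := boolP ((a, b) \in @triangle R).
  have -> : [set c | @simplex3 R (a, b, c)] = `]0, (1 - a - b)[%classic.
    apply/seteqP; split => c /=; rewrite /simplex3/= in_itv/=.
      by case=> _ _ c0 c1; apply/andP; split => //; lra.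
    by move=> /andP[c0 c1]; split => //; lra.
  rewrite integral_cst//.
  rewrite /leb1/= lebesgue_measure_itv/= lte_fin.
  have -> : (0 < 1 - a - b) by lra.
  by rewrite -EFinB -EFinM subr0 mulrA.
have -> : [set c | @simplex3 R (a, b, c)] = set0.
  apply/seteqP; split => c //= [/= a0 b0 c0 abc].
  by apply: ab; apply/mem_set; split => //=; lra.
by rewrite integral_set0.
Qed.

(** * Barycentric coordinates *)

Lemma dotE (R : realType) (x y : pt R) : dot x y = \sum_(i < 3) x 0 i * y 0 i.
Proof. by rewrite /dot mxE; apply: eq_bigr => i _; rewrite mxE. Qed.

Lemma dotDr (R : realType) (n x y : pt R) : dot n (x + y) = dot n x + dot n y.
Proof. by rewrite /dot linearD/= mulmxDr mxE. Qed.

Lemma dotZr (R : realType) (n x : pt R) (c : R) : dot n (c *: x) = c * dot n x.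
Proof. by rewrite /dot linearZ/= -scalemxAr mxE. Qed.

Lemma dot0r (R : realType) (n : pt R) : dot n 0 = 0.
Proof. by rewrite /dot trmx0 mulmx0 mxE. Qed.

Lemma dot_sumr (R : realType) (n : pt R) (I : Type) (s : seq I)
    (P : pred I) (F : I -> pt R) :
  dot n (\sum_(i <- s | P i) F i) = \sum_(i <- s | P i) dot n (F i).
Proof. exact: (big_morph _ (dotDr n) (dot0r n)). Qed.

Lemma affine_comb (R : realType) (f : pt R -> R) (K : simplex R) (a : pt R -> R) :
  is_affine f -> \sum_(z <- K) a z = 1 ->
  f (\sum_(z <- K) a z *: z) = \sum_(z <- K) a z * f z.
Proof.
move=> [n [d fE]] a1; rewrite fE dot_sumr.
under [RHS]eq_bigr do rewrite fE mulrDr.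
rewrite big_split/= -mulr_suml a1 mul1r; congr (_ + _).
by apply: eq_bigr => z _; rewrite dotZr.
Qed.

Lemma sum_delta (R : pzSemiRingType) (T : choiceType) (K : {fset T})
    (a : T -> R) (y : T) :
  y \in K -> \sum_(z <- K) a z * (z == y)%:R = a y.
Proof.
move=> yK; rewrite (bigD1_seq y)//= eqxx mulr1 big1 ?addr0// => z zy.
by rewrite (negbTE zy) mulr0.
Qed.

(** Affine independence says that the square matrix whose rows are the
    vertices with an entry 1 appended is invertible. Its inverse [B] turns a
    point into its barycentric coordinates. *)
Lemma tetra_matrix (R : realType) (K : simplex R) : is_tetrahedron K ->
  exists B : 'M[R]_(3 + 1, 4), forall (x : pt R),
    let a z := (row_mx x 1%:M *m B) 0 (inord (index z K)) in
    [/\ \sum_(z <- K) a z = 1, \sum_(z <- K) a z *: z = x &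
     forall y, x \in K -> y \in K -> a y = (x == y)%:R].
Proof.
move=> [card4 Kfree].
have size4 : size K = 4%N by [].
pose M : 'M[R]_(4, 3 + 1) := \matrix_(i < 4) row_mx (nth 0 K i) 1%:M.
have sumK (V : nmodType) (F : pt R -> V) :
    \sum_(z <- K) F z = \sum_(i < 4) F (nth 0 K i).
  by rewrite (big_nth 0) big_mkord size4.
have indexK (i : 'I_4) : inord (index (nth 0 K i) K) = i.
  by rewrite index_uniq ?inord_val ?size4 ?fset_uniq.
have mulM (v : 'rV[R]_4) : v *m M =
   row_mx (\sum_(i < 4) v 0 i *: nth 0 K i) (\sum_(i < 4) v 0 i)%:M.
  rewrite mulmx_sum_row.
  have -> : \sum_i v 0 i *: row i M =
      \sum_i row_mx (v 0 i *: nth 0 K i) (v 0 i)%:M.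
    by apply: eq_bigr => i _; rewrite rowK scale_row_mx scale_scalar_mx mulr1.
  apply: (big_rec3 (fun x y z => x = row_mx y z%:M)) => [|i x y z _ ->].
    by rewrite raddf0 row_mx0.
  by rewrite add_row_mx raddfD.
have Munit : (M : 'M[R]_4) \in unitmx.
  rewrite -row_free_unit -kermx_eq0; apply/eqP/row_matrixP => i; rewrite row0.
  set v := row i _.
  have : v *m M = row_mx 0 0.
    by rewrite row_mx0; apply/eqP; rewrite -sub_kermx row_sub.
  rewrite mulM => /eq_row_mx[v0 v1].
  have s0 : \sum_(i < 4) v 0 i = 0.
    by move/matrixP: v1 => /(_ 0 0); rewrite !mxE eqxx mulr1n.
  apply/rowP => j; rewrite [RHS]mxE -[in LHS](indexK j).
  apply: (Kfree (fun z => v 0 (inord (index z K))) _ _ (nth 0 K j)).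
  - by rewrite sumK -[RHS]s0; apply: eq_bigr => k _; rewrite indexK.
  - by rewrite sumK -[RHS]v0; apply: eq_bigr => k _; rewrite indexK.
  - by apply: mem_nth; rewrite size4.
exists (invmx (M : 'M[R]_4)) => x a.
have aM : (row_mx x 1%:M *m invmx (M : 'M[R]_4)) *m M = row_mx x 1%:M.
  by rewrite mulmxKV.
move: (aM); rewrite mulM => /eq_row_mx[ax a1]; split.
- rewrite sumK; move/matrixP: a1 => /(_ 0 0); rewrite !mxE eqxx !mulr1n => <-.
  by apply: eq_bigr => i _; rewrite /a indexK.
- by rewrite sumK -[RHS]ax; apply: eq_bigr => i _; rewrite /a indexK.
- move=> y xK yK; rewrite /a.
  have jlt : (index x K < 4)%N by rewrite -size4 index_mem.
  have -> : row_mx x 1%:M = row (Ordinal jlt) M by rewrite rowK /= nth_index.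
  rewrite -row_mul mulmxV// row1 !mxE/= eq_sym; congr (nat_of_bool _)%:R.
  rewrite -val_eqE/= inordK -?size4 ?index_mem//.
  apply/eqP/eqP => [xy|->//].
  by rewrite -(nth_index 0 xK) xy nth_index.
Qed.

Lemma baryP (R : realType) (K : simplex R) (z : pt R) : is_tetrahedron K ->
  z \in K -> is_affine (bary K z) /\ forall y, y \in K -> bary K z y = (y == z)%:R.
Proof.
move=> tK zK; have [B BP] := tetra_matrix tK.
suff ex : exists f : pt R -> R,
    is_affine f /\ forall y, y \in K -> f y = (y == z)%:R.
  exact: (xgetPex (cst 0) ex).
exists (fun x => (row_mx x 1%:M *m B) 0 (inord (index z K))); split; last first.
  by move=> y yK; have [_ _ ->] := BP y.
set j := inord _.
exists (col j (usubmx B))^T, (dsubmx B 0 j) => x.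
rewrite -[B in LHS]vsubmxK mul_row_col mul1mx mxE; congr (_ + _).
by rewrite dotE mxE; apply: eq_bigr => i _; rewrite !mxE mulrC.
Qed.

Lemma bary_decomp (R : realType) (K : simplex R) (x : pt R) : is_tetrahedron K ->
  \sum_(z <- K) bary K z x = 1 /\ \sum_(z <- K) bary K z x *: z = x.
Proof.
move=> tK; have [B /(_ x)[a1 ax _]] := tetra_matrix tK.
pose a z := (row_mx x 1%:M *m B) 0 (inord (index z K)).
rewrite -/(a _) in a1; rewrite -/(a _) in ax.
have aE z : z \in K -> bary K z x = a z.
  move=> zK; have [baff bv] := baryP tK zK.
  rewrite -[in LHS]ax (affine_comb (a := a))// big_seq.
  under eq_bigr => y yK do rewrite bv//.
  by rewrite -big_seq sum_delta.
by split; [rewrite -[RHS]a1|rewrite -[RHS]ax]; apply: eq_big_seq => z zK; rewrite aE.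
Qed.

Lemma bary_comb (R : realType) (K S : simplex R) (z : pt R) (a : pt R -> R) :
  is_tetrahedron K -> z \in K -> (S `<=` K)%fset -> \sum_(y <- S) a y = 1 ->
  bary K z (\sum_(y <- S) a y *: y) = if z \in S then a z else 0.
Proof.
move=> tK zK /fsubsetP SK a1; have [baff bv] := baryP tK zK.
rewrite affine_comb// big_seq; under eq_bigr => y yS do rewrite bv ?SK//.
rewrite -big_seq; case: ifPn => zS; first exact: sum_delta.
rewrite big_seq big1// => y yS; have [yz|] := eqVneq y z; last by rewrite mulr0.
by rewrite -yz yS in zS.
Qed.

Lemma hullE (R : realType) (K : simplex R) : is_tetrahedron K ->
  hull K = [set x | forall z, z \in K -> 0 <= bary K z x].
Proof.
move=> tK; apply/seteqP; split => [x [a [a0 a1 ->]] z zK|x x0].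
  by rewrite (bary_comb tK zK (fsubset_refl K) a1) zK a0.
have [b1 bx] := bary_decomp x tK.
by exists (fun z => bary K z x); split.
Qed.

Lemma continuous_affine (R : realType) (f : pt R -> R) : is_affine f -> continuous f.
Proof.
move=> [n [d fE]].
have h i : continuous (fun x : pt R => n 0 i * x 0 i).
  move=> x; apply: continuousM; first exact: cst_continuous.
  exact: coord_continuous.
have -> : f = (fun x : pt R => n 0 0 * x 0 0) \+
    (fun x : pt R => n 0 (lift ord0 0) * x 0 (lift ord0 0)) \+
    (fun x : pt R => n 0 (lift ord0 (lift ord0 0)) * x 0 (lift ord0 (lift ord0 0)))
    \+ cst d.
  by apply/funext => x; rewrite fE dotE !big_ord_recl big_ord0 addr0/= !addrA.
move=> x; apply: continuousD; last exact: cst_continuous.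
by apply: continuousD; last exact: h; apply: continuousD; exact: h.
Qed.

Lemma near_all_seq (T : eqType) (X : Type) (F : set_system X) (s : seq T)
    (P : T -> X -> Prop) : Filter F ->
  (forall z, z \in s -> \forall x \near F, P z x) ->
  \forall x \near F, forall z, z \in s -> P z x.
Proof.
move=> FF; elim: s => [|z s IH] h; first by near=> x.
have h1 := h z (mem_head z s).
have h2 := IH (fun y ys => h y (mem_behead (s := z :: s) ys)).
apply: filterS2 h1 h2 => x Pz Ps y; rewrite inE => /orP[/eqP->//|]; exact: Ps.
Unshelve. all: by end_near. Qed.

(** The coordinates are continuous, so the right-hand side is open; conversely
    a point with a zero coordinate leaves the hull when moved away from that
    vertex. *)
Lemma interior_hullE (R : realType) (K : simplex R) : is_tetrahedron K ->
  (hull K)° = [set x | forall z, z \in K -> 0 < bary K z x].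
Proof.
move=> tK; apply/seteqP; split => x /=.
  move=> xK z zK; have [baff bv] := baryP tK zK.
  have x0 : 0 <= bary K z x by have := interior_subset xK; rewrite hullE//; apply.
  rewrite lt_neqAle x0 andbT; apply/eqP => bx0.
  (* on the ray from [x] away from [z] the coordinate of [z] is negative *)
  have [n [d bE]] := baff.
  pose c (t : R) := x + t *: (x - z).
  have cc : {for 0, continuous c}.
    apply: (@continuousD _ _ _ (cst x) (fun t : R => t *: (x - z))).
      exact: cst_continuous.
    exact: scalel_continuous.
  have : nbhs (c 0) (hull K) by rewrite /c scale0r addr0; exact: xK.
  move=> /cc/nbhs_ballP[e /= e0 He].
  have /He/= : ball (0 : R) e (e / 2).
    by rewrite -ball_normE/= sub0r normrN gtr0_norm; lra.
  rewrite hullE// => /(_ z zK).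
  rewrite bE dotDr dotZr dotDr -(scaleN1r z) dotZr.
  have -> : dot n x = - d.
    by move: bx0; rewrite bE => /esym/eqP; rewrite addr_eq0 => /eqP.
  have -> : dot n z = 1 - d by rewrite -[1]/(true%:R) -(eqxx z) -bv// bE addrK.
  lra.
move=> x0; apply: (@filterS _ _ _ [set y | forall z, z \in K -> 0 < bary K z y]).
  by move=> y y0; rewrite hullE// => z zK; apply/ltW/y0.
apply: (near_all_seq (F := nbhs x) (s := K)
  (P := fun z y => 0 < bary K z y)) => z zK; have [baff _] := baryP tK zK.
exact: (cvgr_gt (bary K z x) (@continuous_affine _ _ baff x) 0 (x0 z zK)).
Qed.

(** * Barycentric coordinates as an affine change of variables *)

Definition triple_of (R : realType) (v : pt R) : triple R :=
  (v 0 0, v 0 1, v 0 2%:R).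

Lemma triple_ofK (R : realType) : cancel (@triple_of R) (@pt_of R).
Proof.
move=> v; apply/rowP => -[[|[|[|//]]] ilt]; rewrite mxE /=; congr (v _ _);
  exact/val_inj.
Qed.

Lemma pt_ofK (R : realType) : cancel (@pt_of R) (@triple_of R).
Proof. by case=> [[x y] z]; rewrite /triple_of !mxE. Qed.

Lemma pt_of_add3 (R : realType) (u x : triple R) :
  pt_of (add3 u x) = pt_of u + pt_of x.
Proof. by apply/rowP => -[[|[|[|//]]] ilt]; rewrite !mxE. Qed.

Lemma dot_pt_of (R : realType) (n : pt R) (x : triple R) :
  dot n (pt_of x) = n 0 0 * x.1.1 + n 0 1 * x.1.2 + n 0 2%:R * x.2.
Proof.
rewrite dotE !big_ord_recl big_ord0 addr0 !mxE/= addrA.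
by congr (n _ _ * _ + n _ _ * _ + n _ _ * _); exact/val_inj.
Qed.

Lemma measurable_affine (R : realType) (f : pt R -> R) : is_affine f ->
  measurable_fun setT (fun x : triple R => f (pt_of x)).
Proof.
move=> [n [d fE]].
have -> : (fun x : triple R => f (pt_of x)) =
    fun x => n 0 0 * x.1.1 + n 0 1 * x.1.2 + n 0 2%:R * x.2 + d.
  by apply/funext => x; rewrite fE dot_pt_of.
apply: (measurable_funD (g := cst d)) => //.
have m1 := @measurable_fst3 R; have m2 := @measurable_snd3 R.
apply: (measurable_funD (g := fun x : triple R => n 0 2%:R * x.2 : R)).
  apply: (measurable_funD (f := fun x : triple R => n 0 0 * x.1.1 : R)
    (g := fun x : triple R => n 0 1 * x.1.2 : R)).
    exact: (measurable_funM (f := cst (n 0 0)) (g := fun x : triple R => x.1.1 : R)).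
  exact: (measurable_funM (f := cst (n 0 1)) (g := fun x : triple R => x.1.2 : R)).
apply: (measurable_funM (f := cst (n 0 2%:R)) (g := fun x : triple R => x.2 : R)) => //.
exact: measurable_snd.
Qed.

Lemma tetra_vertices (R : realType) (K : simplex R) (a b : pt R) :
  is_tetrahedron K -> a \in K -> b \in K -> a != b ->
  exists c d, perm_eq K [:: a; b; c; d].
Proof.
move=> [K4 _] aK bK ab.
have pa := perm_to_rem aK.
have bK' : b \in rem a K.
  by move: bK; rewrite (perm_mem pa) inE eq_sym (negbTE ab).
have pb := perm_to_rem bK'.
have := perm_size pb; rewrite size_rem// [size K]K4 /= => -[].
move: pb; case: (rem b _) => [//|c [//|d [|//]]] pb _.
exists c, d; apply: (perm_trans pa); rewrite perm_cons; exact: pb.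
Qed.

Lemma tetra_numbering (R : realType) (K : simplex R) : is_tetrahedron K ->
  exists a b c d, perm_eq K [:: a; b; c; d].
Proof.
move=> tK; have [K4 _] := tK.
have /fsubsetPn[a aK _] : ~~ (K `<=` fset0)%fset.
  by rewrite fsubset0 -cardfs_eq0 K4.
have /fsubsetPn[b bK ba] : ~~ (K `<=` [fset a])%fset.
  by apply/negP => /fsubset_leq_card; rewrite cardfs1 K4.
have ab : a != b by rewrite inE eq_sym in ba.
have [c [d KE]] := tetra_vertices tK aK bK ab.
by exists a, b, c, d.
Qed.

(** Three of the four barycentric coordinates, the fourth being determined by
    them: an affine bijection that sends the tetrahedron to the standard
    simplex. *)
Definition bary_map (R : realType) (K : simplex R) (a b c : pt R)
    (x : triple R) : triple R :=
  (bary K a (pt_of x), bary K b (pt_of x), bary K c (pt_of x)).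

Definition bary_map_inv (R : realType) (a b c d : pt R) (y : triple R) :
    triple R :=
  triple_of (y.1.1 *: a + y.1.2 *: b + y.2 *: c
             + (1 - y.1.1 - y.1.2 - y.2) *: d).

Section BaryMap.
Context (R : realType) (K : simplex R) (a b c d : pt R).
Hypotheses (tK : is_tetrahedron K) (KE : perm_eq K [:: a; b; c; d]).

Lemma perm4_mem :
  [/\ a \in K, b \in K, c \in K & d \in K].
Proof. by rewrite !(perm_mem KE) !inE !eqxx !orbT. Qed.

Lemma perm4_neq :
  [/\ a != b, a != c & a != d] /\ [/\ b != c, b != d & c != d].
Proof.
have := fset_uniq K; rewrite (perm_uniq KE)/= !inE !negb_or.
by case/and4P => /and3P[? ? ?] /andP[? ?] ? _.
Qed.

Lemma big_perm4 (V : nmodType) (F : pt R -> V) :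
  \sum_(z <- K) F z = F a + F b + F c + F d.
Proof. by rewrite (perm_big _ KE)/= !big_cons big_nil addr0 !addrA. Qed.

Lemma bary_last (x : pt R) :
  bary K d x = 1 - bary K a x - bary K b x - bary K c x.
Proof.
have [<- _] := bary_decomp x tK.
by rewrite big_perm4; ring.
Qed.

Lemma bary_comb4 (y : pt R -> R) z : z \in K ->
  y a + y b + y c + y d = 1 ->
  bary K z (y a *: a + y b *: b + y c *: c + y d *: d) = y z.
Proof.
move=> zK y1; have := @bary_comb _ K K z y tK zK (fsubset_refl K).
by rewrite !big_perm4 zK; apply.
Qed.

Lemma bary_mapK : cancel (bary_map K a b c) (bary_map_inv a b c d).
Proof.
move=> x; rewrite /bary_map_inv/= -bary_last.
by have [_] := bary_decomp (pt_of x) tK; rewrite big_perm4 => ->; rewrite pt_ofK.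
Qed.

Lemma bary_map_invK : cancel (bary_map_inv a b c d) (bary_map K a b c).
Proof.
move=> [[u v] w]; rewrite /bary_map/bary_map_inv/= triple_ofK.
have [aK bK cK dK] := perm4_mem.
have [[ab ac ad] [bc bd cd]] := perm4_neq.
pose y z := if z == a then u else if z == b then v else
            if z == c then w else 1 - u - v - w.
have ya : y a = u by rewrite /y eqxx.
have yb : y b = v by rewrite /y eq_sym (negbTE ab) eqxx.
have yc : y c = w by rewrite /y eq_sym (negbTE ac) eq_sym (negbTE bc) eqxx.
have yd : y d = 1 - u - v - w.
  by rewrite /y eq_sym (negbTE ad) eq_sym (negbTE bd) eq_sym (negbTE cd).
have y1 : y a + y b + y c + y d = 1 by rewrite ya yb yc yd; ring.
have h z : z \in K ->
    bary K z (u *: a + v *: b + w *: c + (1 - u - v - w) *: d) = y z.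
  by move=> zK; rewrite -(bary_comb4 zK y1) ya yb yc yd.
by rewrite !h// ya yb yc.
Qed.

(** A change of the coordinates by [v] is a displacement along the three edges
    that end in [d]. *)
Lemma bary_map_translation (v : triple R) :
  exists u, forall x,
    bary_map K a b c (add3 u x) = add3 v (bary_map K a b c x).
Proof.
have [aK bK cK dK] := perm4_mem.
have [[ab ac ad] [bc bd cd]] := perm4_neq.
exists (triple_of (v.1.1 *: (a - d) + v.1.2 *: (b - d) + v.2 *: (c - d))) => x.
rewrite /bary_map pt_of_add3 triple_ofK [RHS]/add3/=.
have h z : z \in K -> bary K z (v.1.1 *: (a - d) + v.1.2 *: (b - d) + v.2 *: (c - d)
    + pt_of x) = v.1.1 * ((a == z)%:R - (d == z)%:R) +
    v.1.2 * ((b == z)%:R - (d == z)%:R) + v.2 * ((c == z)%:R - (d == z)%:R) +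
    bary K z (pt_of x).
  move=> zK; have [[n [e nE]] nv] := baryP tK zK.
  rewrite -!nv// !nE !dotDr !dotZr !dotDr -!(scaleN1r d) !dotZr; ring.
rewrite !h// !eqxx [b == a]eq_sym [c == a]eq_sym [c == b]eq_sym.
rewrite [d == a]eq_sym [d == b]eq_sym [d == c]eq_sym.
rewrite (negbTE ab) (negbTE ac) (negbTE ad) (negbTE bc) (negbTE bd) (negbTE cd).
by rewrite /= !mulr1n !mulr0n; congr (_, _, _); ring.
Qed.

Lemma measurable_bary_map : measurable_fun setT (bary_map K a b c).
Proof.
have [aK bK cK dK] := perm4_mem.
apply: measurable_fun_pair; first apply: measurable_fun_pair.
- exact: (measurable_affine (baryP tK aK).1).
- exact: (measurable_affine (baryP tK bK).1).
- exact: (measurable_affine (baryP tK cK).1).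
Qed.

End BaryMap.

Lemma measurable_bary_map_inv (R : realType) (a b c d : pt R) :
  measurable_fun setT (bary_map_inv a b c d).
Proof.
have m1 := @measurable_fst3 R; have m2 := @measurable_snd3 R.
have m3 : measurable_fun setT (fun x : triple R => x.2 : R) by exact: measurable_snd.
have h i : measurable_fun setT (fun y : triple R => (y.1.1 *: a + y.1.2 *: b + y.2 *: c
             + (1 - y.1.1 - y.1.2 - y.2) *: d) 0 i : R).
  have -> : (fun y : triple R => (y.1.1 *: a + y.1.2 *: b + y.2 *: c
             + (1 - y.1.1 - y.1.2 - y.2) *: d) 0 i : R) =
    (fun y : triple R => y.1.1 * (a 0 i - d 0 i) + y.1.2 * (b 0 i - d 0 i) +
       y.2 * (c 0 i - d 0 i) + d 0 i).
    by apply/funext => y; rewrite !mxE; ring.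
  apply: (measurable_funD (g := cst (d 0 i))) => //.
  apply: (measurable_funD (g := fun y : triple R => y.2 * (c 0 i - d 0 i) : R)).
    apply: (measurable_funD (f := fun y : triple R => y.1.1 * (a 0 i - d 0 i) : R)
      (g := fun y : triple R => y.1.2 * (b 0 i - d 0 i) : R)).
      exact: (measurable_funM (g := cst (a 0 i - d 0 i))
        (f := fun x : triple R => x.1.1 : R)).
    exact: (measurable_funM (g := cst (b 0 i - d 0 i))
        (f := fun x : triple R => x.1.2 : R)).
  exact: (measurable_funM (g := cst (c 0 i - d 0 i))
        (f := fun x : triple R => x.2 : R)).
by apply: measurable_fun_pair; first apply: measurable_fun_pair; exact: h.
Qed.

(** * Integrals over a tetrahedron *)

(** Nonnegative functions are treated by the definition of the image measure;
    the general case follows by splitting [f] into its positive and negative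
    parts. *)
Lemma integral_scaled_image d (T : measurableType d) d' (T' : measurableType d')
    (R : realType) (mu : {measure set T -> \bar R})
    (nu : {measure set T' -> \bar R}) (L : T -> T') (c : R) (D : set T')
    (f : T' -> R) :
  0 < c -> measurable_fun setT L -> measurable D -> measurable_fun setT f ->
  (forall A, measurable A -> mu (L @^-1` A) = c%:E * nu A)%E ->
  nu.-integrable D (EFin \o f) ->
  mu.-integrable (L @^-1` D) (EFin \o (f \o L)) /\
  (\int[mu]_(x in L @^-1` D) (f (L x))%:E = c%:E * \int[nu]_(y in D) (f y)%:E)%E.
Proof.
move=> c0 mL mD mf muL fi.
have mEf : measurable_fun setT (EFin \o f) by exact/measurable_EFinP.
have ge0 (g : T' -> \bar R) : measurable_fun setT g -> (forall y, 0 <= g y)%E ->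
    (\int[mu]_(x in L @^-1` D) g (L x) = c%:E * \int[nu]_(y in D) g y)%E.
  move=> mg g0.
  rewrite -[LHS](ge0_integral_pushforward mL)//; last exact: measurable_funTS.
  pose cn := NngNum (ltW c0).
  rewrite -(ge0_integral_mscale nu mD cn)//; last exact: measurable_funTS.
  by apply: eq_measure_integral => A mA _; rewrite /= /pushforward /mscale/= muL.
have i1 : mu.-integrable (L @^-1` D) (EFin \o (f \o L)).
  apply/integrableP; split.
    apply: measurable_funTS; exact: (measurableT_comp mEf mL).
  have /integrableP[_] := fi.
  have := ge0 (fun y => `|(f y)%:E|)%E => /= ->//.
    by move=> h; rewrite lte_mul_pinfty// lee_fin ltW.
  by apply/measurable_EFinP; exact: measurableT_comp.
split=> //.
rewrite integralE [in RHS]integralE muleBr//; last first.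
  exact: (integrable_add_def mD fi).
congr (_ - _)%E.
  rewrite -ge0; [|exact: (measurable_funepos mEf)|by []].
  by apply: eq_integral => x _; rewrite !funeposE.
rewrite -ge0; [|exact: (measurable_funeneg mEf)|by []].
by apply: eq_integral => x _; rewrite !funenegE.
Qed.

Lemma prim_Xn (R : realType) n : prim ('X^n : {poly R}) = n.+1%:R^-1 *: 'X^(n.+1).
Proof.
apply/polyP => i; rewrite coef_prim coefZ !coefXn.
case: i => [|i] /=; first by rewrite invr0 !mulr0.
rewrite eqSS; case: eqP => [->|_]; last by rewrite mul0r mulr0.
by rewrite mul1r mulr1.
Qed.

Lemma simplex_moment11 (R : realType) : simplex_moment 1 1 = 6%:R^-1 :> R.
Proof.
rewrite /simplex_moment mul1r.
have -> : prim (prim (1 : {poly R})) \Po (1 - 'X) =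
    prim (prim 1) \Po ((-1) *: 'X + 1%:P) by rewrite scaleN1r addrC.
rewrite pint_scale ?oppr_eq0 ?oner_eq0//.
have -> : (1 : {poly R}) = 'X^0 by rewrite expr0.
rewrite /pint prim_Xn !linearZ/= prim_Xn !linearZ/= prim_Xn.
by rewrite !(hornerZ, hornerXn); field.
Qed.

Lemma leb3_simplex3 (R : realType) : leb3 R (@simplex3 R) = (6%:R^-1)%:E.
Proof.
rewrite -simplex_moment11 -integral_simplex3.
under eq_integral do rewrite !hornerE.
by rewrite integral_cst ?mul1e//; exact: measurable_simplex3.
Qed.

Section Tetrahedron.
Context (R : realType) (K : simplex R) (a b c d : pt R).
Hypotheses (tK : is_tetrahedron K) (KE : perm_eq K [:: a; b; c; d]).

Lemma interior_preimage :
  @pt_of R @^-1` (hull K)° = bary_map K a b c @^-1` @simplex3 R.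
Proof.
rewrite interior_hullE//; have [aK bK cK dK] := perm4_mem KE.
apply/seteqP; split => x /=.
  move=> x0; have := x0 d dK; rewrite (bary_last tK KE) => h.
  by split; rewrite ?x0//=; lra.
rewrite /simplex3/= => -[a0 b0 c0 abc] z.
rewrite (perm_mem KE) !inE => /or4P[] /eqP -> //.
by rewrite (bary_last tK KE); lra.
Qed.

Lemma hull_preimage :
  @pt_of R @^-1` hull K = bary_map K a b c @^-1`
    [set x | [/\ 0 <= x.1.1, 0 <= x.1.2, 0 <= x.2 & x.1.1 + x.1.2 + x.2 <= 1]].
Proof.
rewrite hullE//; have [aK bK cK dK] := perm4_mem KE.
apply/seteqP; split => x /=.
  move=> x0; have := x0 d dK; rewrite (bary_last tK KE) => h.
  by split; rewrite ?x0//=; lra.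
move=> -[a0 b0 c0 abc] z.
rewrite (perm_mem KE) !inE => /or4P[] /eqP -> //.
by rewrite (bary_last tK KE); lra.
Qed.

Lemma tetra_pushforward : exists2 v : R, 0 < v &
  forall A, measurable A ->
  (leb3 R (bary_map K a b c @^-1` A) = v%:E * leb3 R A)%E.
Proof.
apply: (@affine_pushforward _ _ (bary_map_inv a b c d)).
- exact: measurable_bary_map tK KE.
- exact: measurable_bary_map_inv.
- exact: bary_mapK tK KE.
- exact: bary_map_invK tK KE.
- exact: bary_map_translation tK KE.
Qed.

(** The factor [v] might depend on the numbering of the vertices; it is
    identified with six times the volume in [tetra_integral_vol]. *)
Lemma tetra_integral : exists2 v : R, 0 < v & forall f g : {poly R},
  (lebesgue3 R).-integrable (@pt_of R @^-1` (hull K)°)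
    (fun x => (f.[bary K a (pt_of x)] * g.[bary K b (pt_of x)])%:E) /\
  integral3 (hull K)° (fun x => f.[bary K a x] * g.[bary K b x]) =
  v * simplex_moment f g.
Proof.
have [v v0 vE] := tetra_pushforward.
exists v => // f g.
have mF : measurable_fun setT (fun x : triple R => f.[x.1.1] * g.[x.1.2] : R).
  apply: (measurable_funM (f := fun x : triple R => f.[x.1.1] : R)
    (g := fun x : triple R => g.[x.1.2] : R)); apply: measurable_horner.
    exact: measurable_fst3.
  exact: measurable_snd3.
have [fi fE] := integral_scaled_image v0 (measurable_bary_map tK KE)
   (@measurable_simplex3 R) mF vE (integrable_simplex3 f g).
split; first by rewrite interior_preimage; exact: fi.
rewrite /integral3 interior_preimage /Rintegral.
transitivity (fine (v%:E * (simplex_moment f g)%:E)%E); last by [].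
by rewrite -integral_simplex3; congr fine; exact: fE.
Qed.

End Tetrahedron.

(** * Moments of orthogonal polynomials as a rational function of the order *)

(** For [p] of degree at most [n], the moment [\int_0^1 x^s p] is [\sum_i p_i
    / (s + i + 1)], a rational function of the order [s] with denominator [(s
    + 1) ... (s + n + 1)]. [moment_num n p] is its numerator and [node_prod n
    i] the numerator of the term [1 / (s + i + 1)]. Orthogonality prescribes
    the zeros of the numerator and the value [p(1)] its leading coefficient;
    the coefficients of [p] are recovered as residues. *)
Definition node_prod (R : comNzRingType) n (i : nat) : {poly R} :=
  \prod_(l < n.+1 | l != i :> nat) ('X + l.+1%:R%:P).

Definition moment_num (R : comNzRingType) n (p : {poly R}) : {poly R} :=
  \sum_(i < n.+1) p`_i *: node_prod R n i.

Definition root_prod (R : comNzRingType) n (beta : nat) : {poly R} :=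
  \prod_(m < n) ('X - (beta + m)%:R%:P).

Lemma XaddC (R : nzRingType) (c : R) : 'X + c%:P = 'X - (- c)%:P.
Proof. by rewrite polyCN opprK. Qed.

Lemma monic_node_prod (R : realType) n i : node_prod R n i \is monic.
Proof. by apply: monic_prod => l _; rewrite XaddC monicXsubC. Qed.

Lemma size_prod_lin (R : realType) n (P : pred 'I_n) (F : 'I_n -> R) :
  size (\prod_(l < n | P l) ('X - (F l)%:P)) = #|P|.+1.
Proof.
rewrite -big_filter.
rewrite -(big_map F xpredT (fun c => 'X - c%:P)) size_prod_XsubC size_map.
by rewrite size_filter -sum1_count -sum1_card.
Qed.

Lemma size_node_prod (R : realType) n i : (i < n.+1)%N ->
  size (node_prod R n i) = n.+1.
Proof.
move=> iN; rewrite /node_prod.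
under eq_bigr do rewrite XaddC.
rewrite size_prod_lin.
have [c] : (1 + #|predC1 (Ordinal iN)|)%N = n.+1.
  by rewrite -[RHS]card_ord -(cardC (pred1 (Ordinal iN))) card1.
by congr _.+1; rewrite -[RHS]c; apply: eq_card => l; rewrite !inE -val_eqE.
Qed.

Lemma size_root_prod (R : realType) n beta : size (root_prod R n beta) = n.+1.
Proof. by rewrite /root_prod size_prod_lin cardT size_enum_ord. Qed.

Lemma monic_root_prod (R : realType) n beta : root_prod R n beta \is monic.
Proof. by apply: monic_prod => l _; rewrite monicXsubC. Qed.

Lemma size_moment_num (R : realType) n (p : {poly R}) :
  (size (moment_num n p) <= n.+1)%N.
Proof.
apply: (leq_trans (size_sum _ _ _)); apply/bigmax_leqP => i _.
by rewrite (leq_trans (size_scale_leq _ _))// size_node_prod.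
Qed.

Lemma horner1_sum (R : realType) n (p : {poly R}) : (size p <= n.+1)%N ->
  p.[1] = \sum_(i < n.+1) p`_i.
Proof.
move=> sp; rewrite (horner_coef_wide _ sp).
by apply: eq_bigr => i _; rewrite expr1n mulr1.
Qed.

Lemma coef_moment_num (R : realType) n (p : {poly R}) : (size p <= n.+1)%N ->
  (moment_num n p)`_n = p.[1].
Proof.
move=> sp; rewrite (horner1_sum sp) coef_sum; apply: eq_bigr => i _.
rewrite coefZ -[RHS]mulr1; congr (_ * _).
have /monicP := monic_node_prod R n i.
by rewrite lead_coefE size_node_prod.
Qed.

Lemma moment_num_node (R : realType) n (p : {poly R}) i : (i < n.+1)%N ->
  (moment_num n p).[- i.+1%:R] = p`_i * (node_prod R n i).[- i.+1%:R].
Proof.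
move=> iN; rewrite /moment_num horner_sum (bigD1 (Ordinal iN))//= hornerZ.
rewrite big1 ?addr0// => l li; rewrite hornerZ /node_prod horner_prod.
rewrite (bigD1 (Ordinal iN))/= ?hornerD ?hornerX ?hornerC ?addNr ?mul0r ?mulr0//.
by rewrite eq_sym.
Qed.

Lemma poly_sum_coef (R : nzRingType) n (p : {poly R}) : (size p <= n)%N ->
  p = \sum_(i < n) p`_i *: 'X^i.
Proof.
move=> sp; rewrite -[LHS](coefK p) poly_def.
rewrite (big_ord_widen _ (fun i => p`_i *: 'X^i) sp) big_mkcond/=.
apply: eq_bigr => i _; case: ltnP => // ?.
by rewrite nth_default// scale0r.
Qed.

Lemma moment01 (R : realType) n (p : {poly R}) j : (size p <= n.+1)%N ->
  pint 0 1 ('X^j * p) = \sum_(i < n.+1) p`_i / (i + j).+1%:R.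
Proof.
move=> sp; rewrite {1}(poly_sum_coef sp).
rewrite mulr_sumr linear_sum/=; apply: eq_bigr => i _.
rewrite -scalerAr linearZ/= -exprD addnC.
have -> : 'X^(i + j) = ((i + j).+1%:R^-1 *: 'X^((i + j).+1))^`() :> {poly R}.
  by rewrite derivZ derivXn -(scaler_nat _ ('X^_)) scalerA mulVf ?scale1r// pnatr_eq0.
by rewrite pint_deriv !(hornerZ, hornerXn) expr1n expr0n/= mulr1 mulr0 subr0.
Qed.

Lemma moment_num_moment (R : realType) n (p : {poly R}) j :
  (size p <= n.+1)%N ->
  (moment_num n p).[j%:R] =
  pint 0 1 ('X^j * p) * \prod_(l < n.+1) (j + l.+1)%:R.
Proof.
move=> sp; rewrite (moment01 _ sp) mulr_suml /moment_num horner_sum.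
apply: eq_bigr => i _; rewrite hornerZ -mulrA; congr (_ * _).
rewrite (bigD1 i)//= mulrA [(j + i.+1)%N]addnC addSn mulVf ?mul1r ?pnatr_eq0//.
rewrite /node_prod horner_prod; apply: eq_bigr => l _.
by rewrite !(hornerD, hornerX, hornerC) natrD.
Qed.

(** The [n] vanishing moments are [n] roots of the numerator, and both sides
    have the same coefficient of degree [n], so their difference has more
    roots than its degree allows. *)
Lemma moment_num_orthogonal (R : realType) n beta (p : {poly R}) :
  (size p <= n.+1)%N ->
  (forall m, (m < n)%N -> pint 0 1 ('X^(beta + m) * p) = 0) ->
  moment_num n p = p.[1] *: root_prod R n beta.
Proof.
move=> sp p0; apply/eqP; rewrite -subr_eq0; apply/eqP.
set D := _ - _.
have sD : (size D <= n)%N.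
  apply/leq_sizeP => i; rewrite leq_eqVlt => /orP[/eqP<-|ni].
    rewrite coefB coefZ coef_moment_num//.
    have /monicP := monic_root_prod R n beta; rewrite lead_coefE size_root_prod /= => ->.
    by rewrite mulr1 subrr.
  rewrite nth_default// (leq_trans (size_polyD _ _))// geq_max size_polyN.
  rewrite (leq_trans (size_moment_num _ _))//=.
  by rewrite (leq_trans (size_scale_leq _ _))// size_root_prod.
apply: (@roots_geq_poly_eq0 _ _ [seq (beta + m)%:R | m <- iota 0 n]).
- apply/allP => _ /mapP[m + ->]; rewrite mem_iota/= add0n => mn.
  rewrite rootE hornerD hornerN hornerZ moment_num_moment// p0// mul0r sub0r oppr_eq0.
  rewrite /root_prod horner_prod (bigD1 (Ordinal mn))//=.
  by rewrite hornerXsubC subrr mul0r mulr0.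
- rewrite map_inj_uniq ?iota_uniq// => x y /eqP.
  by rewrite eqr_nat eqn_add2l => /eqP.
- by rewrite size_map size_iota.
Qed.

Lemma node_prod_node (R : realType) n i : (node_prod R n i).[- i.+1%:R] =
  \prod_(l < n.+1 | l != i :> nat) (l%:R - i%:R).
Proof.
rewrite /node_prod horner_prod; apply: eq_bigr => l _.
rewrite hornerD hornerX hornerC -!natr1; ring.
Qed.

Lemma node_prod_node_neq0 (R : realType) n i : (node_prod R n i).[- i.+1%:R] != 0.
Proof.
rewrite node_prod_node; apply/prodf_neq0 => l li.
by rewrite subr_eq0 eqr_nat.
Qed.

(** Partial fractions: the coefficients of [p] are read off from the values of
    [q] at the poles. *)
Lemma moment_num_surj (R : realType) n (q : {poly R}) : (size q <= n.+1)%N ->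
  exists2 p : {poly R}, (size p <= n.+1)%N & moment_num n p = q.
Proof.
move=> sq.
pose p := \poly_(i < n.+1) (q.[- i.+1%:R] / (node_prod R n i).[- i.+1%:R]).
have sp : (size p <= n.+1)%N by exact: size_poly.
exists p => //; apply/eqP; rewrite -subr_eq0; apply/eqP.
apply: (@roots_geq_poly_eq0 _ _ [seq - i.+1%:R | i <- iota 0 n.+1]).
- apply/allP => _ /mapP[i + ->]; rewrite mem_iota/= add0n => iN.
  rewrite rootE hornerD hornerN moment_num_node// coef_poly iN divfK ?subrr//.
  exact: node_prod_node_neq0.
- rewrite map_inj_uniq ?iota_uniq// => x y /oppr_inj/eqP.
  by rewrite eqr_nat eqSS => /eqP.
- rewrite size_map size_iota (leq_trans (size_polyD _ _))// geq_max size_polyN sq.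
  by rewrite size_moment_num.
Qed.

(** * Jacobi and Legendre polynomials *)

Definition to01 (R : realType) : {poly R} := 2%:R *: 'X + (-1)%:P.
Definition from01 (R : realType) : {poly R} := 2%:R^-1 *: 'X + (2%:R^-1)%:P.

Lemma from01K (R : realType) (p : {poly R}) : (p \Po from01 R) \Po to01 R = p.
Proof.
rewrite -comp_polyA /to01 /from01 comp_polyD comp_polyZ comp_polyX comp_polyC.
rewrite scalerDr scalerA mulVf// scale1r -mul_polyC -polyCM mulrN1.
by rewrite -addrA -polyCD addNr addr0 comp_polyXr.
Qed.

Lemma size_to01 (R : realType) : size (to01 R) = 2%N.
Proof.
rewrite /to01 -mul_polyC size_MXaddC polyC_eq0 pnatr_eq0/=.
by rewrite size_polyC pnatr_eq0.
Qed.

Lemma size_from01 (R : realType) : size (from01 R) = 2%N.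
Proof.
rewrite /from01 -mul_polyC size_MXaddC polyC_eq0 invr_eq0 pnatr_eq0/=.
by rewrite size_polyC invr_eq0 pnatr_eq0.
Qed.

Lemma pint_to01 (R : realType) (p : {poly R}) :
  pint (-1) 1 p = 2%:R * pint 0 1 (p \Po to01 R).
Proof.
rewrite pint_scale// mulr0 add0r mulr1 mulrA mulfV// mul1r.
by congr (pint _ _ _); ring.
Qed.

Lemma to01_1addX (R : realType) j :
  (1 + 'X : {poly R}) ^+ j \Po to01 R = 2%:R ^+ j *: 'X^j.
Proof.
rewrite rmorphXn/= comp_polyD comp_polyX comp_polyC /to01.
have -> : 1%:P + (2%:R *: 'X + (-1)%:P) = 2%:R *: 'X :> {poly R}.
  by rewrite addrC -addrA -polyCD addNr addr0.
by rewrite exprZn.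
Qed.

Lemma pint_weight (R : realType) (p : {poly R}) j :
  pint (-1) 1 ((1 + 'X) ^+ j * p) =
  2%:R ^+ j.+1 * pint 0 1 ('X^j * (p \Po to01 R)).
Proof.
rewrite pint_to01 comp_polyM to01_1addX -scalerAl linearZ/= mulrA -exprS.
by [].
Qed.

Lemma Rintegral_poly (R : realType) (p : {poly R}) :
  \int[lebesgue_measure]_(x in `[-1, 1]) p.[x] = pint (-1) 1 p.
Proof. by rewrite /Rintegral integral_poly_itv//; lra. Qed.

Lemma prod_fact (R : realType) n : \prod_(m < n) (1 + m)%:R = n`!%:R :> R.
Proof. by rewrite fact_prod big_add1 /= big_mkord natr_prod. Qed.

(** For [alpha = 0] the normalization is [P(1) = n! / n! = 1]. *)
Lemma is_jacobiP (R : realType) n beta (P : {poly R}) :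
  is_jacobi n 0 beta P <->
  [/\ size P = n.+1, P.[1] = 1 & forall q : {poly R}, (size q <= n)%N ->
     pint (-1) 1 ((1 + 'X) ^+ beta * (P * q)) = 0].
Proof.
have wE (q : {poly R}) :
    \int[lebesgue_measure]_(x in `[-1, 1]) (jacobi_weight 0 beta x * P.[x] * q.[x])
    = pint (-1) 1 ((1 + 'X) ^+ beta * (P * q)).
  rewrite -Rintegral_poly; apply: eq_Rintegral => x _.
  rewrite /jacobi_weight expr0 mul1r.
  by rewrite !(hornerM, hornerD, horner_exp, hornerX, hornerC) mulrA.
rewrite /is_jacobi prod_fact mulfV; last by rewrite pnatr_eq0 -lt0n fact_gt0.
split.
  by case=> sP oP P1; split => // q sq; rewrite -wE oP.
by case=> sP P1 oP; split => // q sq; rewrite wE oP.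
Qed.

(** Take the polynomial whose numerator is [root_prod n beta], transported
    from [0, 1] to [-1, 1]. Its degree is exactly [n] because the residue at
    the last pole is nonzero. *)
Lemma jacobi_exists (R : realType) n beta : exists P : {poly R}, is_jacobi n 0 beta P.
Proof.
have [p sp pE] := moment_num_surj (eq_leq (size_root_prod R n beta)).
exists (p \Po from01 R); apply/is_jacobiP.
have p1 : p.[1] = 1.
  rewrite -(coef_moment_num sp) pE.
  by have /monicP := monic_root_prod R n beta; rewrite lead_coefE size_root_prod.
have p0 m : (m < n)%N -> pint 0 1 ('X^(beta + m) * p) = 0.
  move=> mn; have := moment_num_moment (beta + m) sp.
  have -> : (moment_num n p).[(beta + m)%:R] = 0.
    rewrite pE /root_prod horner_prod (bigD1 (Ordinal mn))//=.
    by rewrite hornerXsubC subrr mul0r.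
  move=> /esym/eqP; rewrite mulf_eq0 => /orP[/eqP//|].
  by rewrite prodf_seq_eq0 => /hasP[l _ /=]; rewrite addnS pnatr_eq0.
split.
- rewrite size_comp_poly2 ?size_from01//; apply/eqP; rewrite eqn_leq sp/=.
  rewrite ltnNge; apply/negP => pn.
  have := moment_num_node p (ltnSn n); rewrite pE nth_default// mul0r => /eqP.
  rewrite /root_prod horner_prod prodf_seq_eq0 => /hasP[m _ /=].
  rewrite hornerXsubC -opprD oppr_eq0 -natrD pnatr_eq0 //.
- rewrite horner_comp /from01 !(hornerD, hornerZ, hornerX, hornerC).
  by rewrite -[RHS]p1; congr _.[_]; field.
- move=> q sq; rewrite pint_weight comp_polyM from01K.
  set r := q \Po _.
  have sr : (size r <= n)%N by rewrite size_comp_poly2 ?size_to01.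
  rewrite (poly_sum_coef sr).
  rewrite mulr_sumr mulr_sumr linear_sum/= big1 ?mulr0// => m _.
  by rewrite -!scalerAr linearZ/= mulrCA -exprD [p * _]mulrC p0 ?mulr0.
Qed.

Lemma orthogonal_moment_num (R : realType) n beta (P : {poly R}) :
  (size P <= n.+1)%N ->
  (forall q : {poly R}, (size q <= n)%N ->
     pint (-1) 1 ((1 + 'X) ^+ beta * (P * q)) = 0) ->
  moment_num n (P \Po to01 R) = P.[1] *: root_prod R n beta.
Proof.
move=> sP oP.
rewrite (@moment_num_orthogonal _ _ beta).
- rewrite horner_comp /to01 !(hornerD, hornerZ, hornerX, hornerC).
  by congr (_.[_] *: _); ring.
- by rewrite size_comp_poly2 ?size_to01.
- move=> m mn; have := oP ((1 + 'X) ^+ m).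
  have sm : (size ((1 + 'X : {poly R}) ^+ m) <= n)%N.
    by rewrite addrC -[1]/(1%:P) XaddC size_exp_XsubC.
  move=> /(_ sm); rewrite [P * _]mulrC mulrA -exprD pint_weight => /eqP.
  by rewrite mulf_eq0 expf_eq0 pnatr_eq0 andbF/= => /eqP.
Qed.

Lemma prodrN_ord (R : comNzRingType) n (F : 'I_n -> R) :
  \prod_(m < n) (- F m) = (-1) ^+ n * \prod_(m < n) F m.
Proof.
under eq_bigr do rewrite -mulN1r.
by rewrite big_split/= prodr_const card_ord.
Qed.

Lemma root_prod_sign (R : realType) n beta (x : R) :
  (root_prod R n beta).[x] = (-1) ^+ n * \prod_(m < n) ((beta + m)%:R - x).
Proof.
rewrite /root_prod horner_prod -prodrN_ord; apply: eq_bigr => m _.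
by rewrite hornerXsubC opprB.
Qed.

Lemma deriv_to01 (R : realType) (P : {poly R}) :
  (P \Po to01 R)^`() = 2%:R *: (P^`() \Po to01 R).
Proof.
rewrite deriv_comp /to01 derivD derivZ derivX derivC addr0 -scalerAr mulr1 //.
Qed.

Lemma to01_at0 (R : realType) (P : {poly R}) : (P \Po to01 R)`_0 = P.[-1].
Proof.
rewrite -horner_coef0 horner_comp /to01 !(hornerD, hornerZ, hornerX, hornerC).
by rewrite mulr0 add0r.
Qed.

Lemma to01_at1 (R : realType) (P : {poly R}) :
  (P \Po to01 R)`_1 = 2%:R * P^`().[-1].
Proof.
rewrite -to01_at0 -coefZ -deriv_to01 coef_deriv mulr1n //.
Qed.

Lemma to01_at2 (R : realType) (P : {poly R}) :
  (P \Po to01 R)`_2 = 2%:R * P^`()^`().[-1].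
Proof.
have := to01_at1 P^`().
have -> : (P^`() \Po to01 R) = 2%:R^-1 *: (P \Po to01 R)^`().
  by rewrite deriv_to01 scalerA mulVf ?scale1r.
by rewrite coefZ coef_deriv => <-; rewrite -[_`_2 *+ 2]mulr_natl mulrA mulVf ?mul1r.
Qed.

Section Orthogonal.
Context (R : realType) (n : nat) (P : {poly R}).
Hypotheses (sP : (size P <= n.+1)%N)
  (oP : forall q : {poly R}, (size q <= n)%N -> pint (-1) 1 (P * q) = 0).

(** The residue at the pole [- (i + 1)], which determines the coefficients of
    [P] in powers of [(1 + X) / 2], that is, its derivatives at [-1]. *)
Lemma orthogonal_coef i : (i < n.+1)%N ->
  (P \Po to01 R)`_i * \prod_(l < n.+1 | l != i :> nat) (l%:R - i%:R) =
  P.[1] * ((-1) ^+ n * \prod_(m < n) (i.+1 + m)%:R).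
Proof.
move=> iN; rewrite -node_prod_node -moment_num_node// (@orthogonal_moment_num _ _ 0)//.
  rewrite hornerZ root_prod_sign; congr (_ * (_ * _)).
  by apply: eq_bigr => m _; rewrite opprK add0n natrD addrC.
by move=> q sq; rewrite expr0 mul1r oP.
Qed.

Lemma orthogonal_at_m1 : P.[-1] = (-1) ^+ n * P.[1].
Proof.
have := orthogonal_coef (ltn0Sn n); rewrite to01_at0 prod_fact.
rewrite big_mkcond big_ord_recl/= mul1r.
under eq_bigr do rewrite /= subr0.
rewrite prod_fact mulrCA mulrA => /mulIf -> //.
Qed.

Lemma orthogonal_deriv_m1 : (0 < n)%N ->
  P^`().[-1] = - ((-1) ^+ n * P.[1] * (n * n.+1)%:R / 2%:R).
Proof.
move=> n0; have := orthogonal_coef (n0 : 1 < n.+1)%N; rewrite to01_at1.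
rewrite big_mkcond big_ord_recl/= sub0r.
have -> : \prod_(m < n) (2 + m)%:R = (n.+1)`!%:R :> R.
  by rewrite -prod_fact big_ord_recl/= addn0 mul1r.
move: n0; case: n => // k _.
rewrite big_ord_recl/= mul1r.
have -> : \prod_(i < k) (if lift ord0 (lift ord0 i) != 1 :> nat
    then (lift ord0 (lift ord0 i))%:R - 1 else 1) = k`!%:R :> R.
  rewrite -prod_fact; apply: eq_bigr => i _ /=.
  by rewrite /bump/= !add1n/= -natr1 addrK.
rewrite !factS !natrM.
have k0 : k`!%:R != 0 :> R by rewrite pnatr_eq0 -lt0n fact_gt0.
move=> h; apply: (mulIf k0).
have -> : P^`().[-1] * k`!%:R = - (2%:R * P^`().[-1] * (-1 * k`!%:R)) / 2%:R by field.
by rewrite h; field.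
Qed.

Lemma orthogonal_deriv2_m1 : (1 < n)%N ->
  exists2 c : R, 0 < c & P^`()^`().[-1] = (-1) ^+ n * P.[1] * c.
Proof.
move=> n1; have := orthogonal_coef (n1 : 2 < n.+1)%N; rewrite to01_at2.
set D := \prod_(l < n.+1 | _) _; set F := \prod_(m < n) _.
have D0 : 0 < D.
  rewrite /D; move: n1; case: n => // -[//|k] _.
  rewrite big_mkcond !big_ord_recl/= mul1r mulrA -mulr_natl mulr1 sub0r.
  apply: mulr_gt0; first by rewrite /bump/=; lra.
  apply: prodr_gt0 => l _ /=; rewrite /bump/= !add1n/= subr_gt0 ltr_nat//.
have F0 : 0 < F by apply: prodr_gt0 => m _; rewrite ltr0n.
move=> h; exists (F / (2%:R * D)); first by rewrite divr_gt0// mulr_gt0.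
apply: (mulIf (lt0r_neq0 D0)); apply: (mulfI (x := 2%:R)); first by rewrite pnatr_eq0.
rewrite mulrA h; field; exact: lt0r_neq0.
Qed.

End Orthogonal.

Lemma comp_reflectK (R : realType) (p : {poly R}) :
  (p \Po - 'X) \Po - 'X = p.
Proof.
by rewrite -comp_polyA raddfN/= comp_polyX opprK comp_polyXr.
Qed.

Lemma size_comp_reflect (R : realType) (p : {poly R}) :
  size (p \Po - 'X) = size p.
Proof. by rewrite size_comp_poly2// size_polyN size_polyX. Qed.

Lemma pint_reflect (R : realType) (p : {poly R}) :
  pint (-1) 1 (p \Po - 'X) = pint (-1) 1 p.
Proof.
have -> : p \Po - 'X = p \Po ((-1) *: 'X + 0%:P) by rewrite scaleN1r addr0.
rewrite pint_scale ?oppr_eq0 ?oner_eq0// !addr0 mulrN1 opprK mulr1.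
by rewrite /pint invrN1; ring.
Qed.

Lemma legendreP (R : realType) n :
  [/\ size (legendre R n) = n.+1, (legendre R n).[1] = 1 & forall q : {poly R},
   (size q <= n)%N -> pint (-1) 1 (legendre R n * q) = 0].
Proof.
have /is_jacobiP[sP P1 oP] : is_jacobi n 0 0 (legendre R n).
  exact: (xgetPex 0 (jacobi_exists R n 0)).
by split => // q sq; rewrite -(oP q sq) expr0 mul1r.
Qed.

(** The endpoint 1 is reached from [-1] by reflection: [L(-X)] is orthogonal
    to the same polynomials as [L]. *)
Lemma legendre_deriv1 (R : realType) n : (0 < n)%N ->
  (legendre R n)^`().[1] = (n * n.+1)%:R / 2%:R.
Proof.
move=> n0; have [sL L1 oL] := legendreP R n.
set L := legendre R n in sL L1 oL *.
have Lm1 : L.[-1] = (-1) ^+ n by rewrite (orthogonal_at_m1 (eq_leq sL) oL) L1 mulr1.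
have sP : (size (L \Po - 'X) <= n.+1)%N by rewrite size_comp_reflect sL.
have oP (q : {poly R}) : (size q <= n)%N -> pint (-1) 1 ((L \Po - 'X) * q) = 0.
  move=> sq; rewrite -[q]comp_reflectK -comp_polyM pint_reflect oL//.
  by rewrite size_comp_reflect.
have := orthogonal_deriv_m1 sP oP n0.
rewrite deriv_comp derivN derivX mulrN1 hornerN !horner_comp !hornerN !hornerX opprK.
by rewrite Lm1 -exprMn mulrNN mulr1 expr1n mul1r => /oppr_inj.
Qed.

(** For an order [j] smaller than [beta], every factor [j - (beta + m)] of the
    numerator is negative. *)
Lemma jacobi_moment_sign (R : realType) n beta j (P : {poly R}) :
  is_jacobi n 0 beta P -> (j < beta)%N ->
  0 < (-1) ^+ n * pint (-1) 1 ((1 + 'X) ^+ j * P).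
Proof.
move=> /is_jacobiP[sP P1 oP] jb; rewrite pint_weight.
have s01 : (size (P \Po to01 R) <= n.+1)%N by rewrite size_comp_poly2 ?size_to01 ?sP.
have := moment_num_moment j s01; rewrite (orthogonal_moment_num (eq_leq sP) oP).
rewrite P1 scale1r root_prod_sign.
set D := \prod_(l < n.+1) _; set F := \prod_(m < n) _.
have D0 : 0 < D by apply: prodr_gt0 => l _; rewrite addnS ltr0n.
have F0 : 0 < F.
  by apply: prodr_gt0 => m _; rewrite subr_gt0 ltr_nat; apply: ltn_addr.
set m := pint _ _ _ => h.
rewrite mulrCA mulr_gt0 ?exprn_gt0//.
have : 0 < (-1) ^+ n * m * D by rewrite -mulrA -h mulrA -expr2 sqrr_sign mul1r.
by rewrite pmulr_lgt0.
Qed.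

(** * The two moments that decide the theorem *)

(** The argument [1 - 2 lambda] of the pressure and velocity functions. *)
Definition bary_arg (R : realType) : {poly R} := (-2%:R) *: 'X + 1%:P.

Lemma prim_unique (R : realType) (p q : {poly R}) :
  q^`() = p -> q.[0] = 0 -> prim p = q.
Proof.
move=> qp q0; apply/eqP; rewrite -subr_eq0.
have := @deriv_eq0 _ (prim p - q); rewrite derivB deriv_prim qp subrr => /(_ erefl) ->.
by rewrite -horner_coef0 hornerD hornerN prim0 q0 subrr.
Qed.

Lemma deriv_bary_arg (R : realType) (p : {poly R}) :
  (p \Po bary_arg R)^`() = (-2%:R) *: (p^`() \Po bary_arg R).
Proof.
by rewrite deriv_comp /bary_arg derivD derivZ derivX derivC addr0 -scalerAr mulr1.
Qed.

(** Integrating [W''] twice along the slices produces [W] and the boundary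
    terms at 1. In the variable [t = 1 - 2 a], the point [1 - a] of the
    opposite end of the slice corresponds to [- t]. *)
Lemma simplex_moment_bary_arg (R : realType) (F W : {poly R}) :
  simplex_moment (F \Po bary_arg R) (W^`()^`() \Po bary_arg R) =
  8%:R^-1 * pint (-1) 1
    (F * ((W \Po - 'X) - (W.[1])%:P + W^`().[1] *: (1 + 'X))).
Proof.
rewrite /simplex_moment.
have p1 : prim (W^`()^`() \Po bary_arg R) =
    (- 2%:R^-1) *: ((W^`() \Po bary_arg R) - (W^`().[1])%:P).
  apply: prim_unique.
    by rewrite derivZ derivB derivC subr0 deriv_bary_arg scalerA mulrNN mulVf// scale1r.
  rewrite hornerZ hornerD hornerN hornerC horner_comp /bary_arg.
  by rewrite !(hornerD, hornerZ, hornerX, hornerC) mulr0 add0r subrr mulr0.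
have p2 : prim (prim (W^`()^`() \Po bary_arg R)) =
    4%:R^-1 *: ((W \Po bary_arg R) - (W.[1])%:P) + (2%:R^-1 * W^`().[1]) *: 'X.
  rewrite p1; apply: prim_unique.
    rewrite derivD !derivZ derivB derivC subr0 derivX deriv_bary_arg.
    rewrite scalerBr scalerA -!mul_polyC mulr1.
    have -> : 4%:R^-1 * - 2%:R = - 2%:R^-1 :> R by field.
    by rewrite !polyCM; ring.
  rewrite !(hornerD, hornerN, hornerZ, hornerC, hornerX) horner_comp /bary_arg.
  by rewrite !(hornerD, hornerZ, hornerX, hornerC) !mulr0 add0r subrr mulr0 addr0.
rewrite p2.
set H := (W \Po - 'X) - _ + _.
have -> : (4%:R^-1 *: ((W \Po bary_arg R) - (W.[1])%:P) +
      (2%:R^-1 * W^`().[1]) *: 'X) \Po (1 - 'X) = 4%:R^-1 *: (H \Po bary_arg R).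
  have c1 : bary_arg R \Po (1 - 'X) = - 'X \Po bary_arg R.
    rewrite /bary_arg comp_polyD comp_polyZ comp_polyC comp_polyX raddfN/= comp_polyX.
    by rewrite -!mul_polyC; rewrite polyCN; ring.
  rewrite comp_polyD !comp_polyZ raddfB/= comp_polyC comp_polyX -comp_polyA c1.
  rewrite /H comp_polyD comp_polyZ comp_polyB comp_polyC comp_polyA.
  rewrite comp_polyD comp_polyX comp_polyC.
  have -> : 1%:P + bary_arg R = 2%:R *: (1 - 'X).
    by rewrite /bary_arg scaleNr !scaler_nat polyC1; ring.
  rewrite [RHS]scalerDr !scalerA scalerBr; congr (_ + _ *: _).
  by field.
rewrite -scalerAr linearZ/= -comp_polyM /bary_arg pint_scale ?oppr_eq0 ?pnatr_eq0//.
rewrite mulr0 add0r mulr1.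
have -> : -2%:R + 1 = -1 :> R by ring.
by rewrite /pint; field.
Qed.

(** The previous lemma for [W = X^2 / 2], where the bracket is [(1 + X)^2 /
    2]. *)
Lemma simplex_moment_bary_arg1 (R : realType) (F : {poly R}) :
  simplex_moment (F \Po bary_arg R) 1 = 16%:R^-1 * pint (-1) 1 ((1 + 'X) ^+ 2 * F).
Proof.
pose W : {poly R} := 2%:R^-1 *: 'X^2.
have W1 : W^`() = 'X.
  by rewrite derivZ derivXn expr1 -(scaler_nat _ 'X) scalerA mulVf ?scale1r.
have W2 : W^`()^`() \Po bary_arg R = 1.
  by rewrite W1 derivX -polyC1 comp_polyC.
rewrite -[X in simplex_moment _ X]W2 simplex_moment_bary_arg W1 hornerX scale1r.
have -> : (W \Po - 'X) - (W.[1])%:P + (1 + 'X) = 2%:R^-1 *: (1 + 'X) ^+ 2.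
  rewrite /W comp_polyZ rmorphXn/= comp_polyX hornerZ hornerXn expr1n mulr1.
  have -> : (1 + 'X) ^+ 2 = ((- 'X) ^+ 2 - 1) + 2%:R *: (1 + 'X) :> {poly R}.
    by rewrite scaler_nat; ring.
  rewrite scalerDr scalerA mulVf ?scale1r// scalerBr; congr (_ - _ + _).
  by rewrite -mul_polyC mulr1.
rewrite -scalerAr linearZ/= mulrA [F * _]mulrC.
by congr (_ * _); field.
Qed.

(** With weight [(1 + X)^2] instead of [(1 + X)^3], only the constant term of
    [D] at [-1] survives: the rest of [D] supplies the missing factor [1 + X].
    *)
Lemma pint_orthogonal_weight2 (R : realType) n (J D : {poly R}) :
  is_jacobi n 0 3 J -> (size D <= n.+1)%N ->
  pint (-1) 1 ((1 + 'X) ^+ 2 * (J * D)) =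
  D.[-1] * pint (-1) 1 ((1 + 'X) ^+ 2 * J).
Proof.
move=> /is_jacobiP[sJ J1 oJ] sD.
have rD : root (D - (D.[-1])%:P) (-1) by rewrite rootE hornerD hornerN hornerC subrr.
have [q qE] := factor_theorem (D - (D.[-1])%:P) (-1) rD.
have XE : 'X - (-1)%:P = 1 + 'X :> {poly R} by rewrite polyCN polyC1 opprK addrC.
rewrite XE in qE.
have sq : (size q <= n)%N.
  have : (size (D - (D.[-1])%:P)%R <= n.+1)%N.
    rewrite (leq_trans (size_polyD _ _))// geq_max sD size_polyN.
    by rewrite (leq_trans (size_polyC_leq1 _)).
  rewrite qE; have [->|q0] := eqVneq q 0; first by rewrite size_poly0.
  rewrite size_mul// -?XE ?polyXsubC_eq0// size_XsubC addn2 /=.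
  done.
have -> : D = q * (1 + 'X) + (D.[-1])%:P by rewrite -qE subrK.
rewrite mulrDr mulrDr linearD/= hornerD hornerM hornerD hornerX hornerC.
rewrite (_ : (1 + 'X) ^+ 2 * (J * (q * (1 + 'X))) = (1 + 'X) ^+ 3 * (J * q)); last by ring.
rewrite oJ// add0r hornerC.
have -> : (1 : R) + -1 = 0 by rewrite subrr.
rewrite mulr0 add0r.
by rewrite [J * _]mulrC mul_polyC -scalerAr linearZ.
Qed.

(** Write [Q = W'] with [W = (L_(k+1) - L_k) / (k + 1)]. The first moment is
    [W''(-1) / 16] times the moment of order 2 of [J], and both factors are
    negative because [k] is even. The second is [W'(1) / 8] times the negative
    moment of order 1, since [W(-X)] is orthogonal to [J], whose degree is
    less than [k]. *)
Lemma simplex_moment_gap (R : realType) k (J : {poly R}) : (4 <= k)%N -> ~~ odd k ->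
  is_jacobi k.-1 0 3 J ->
  0 < simplex_moment ((J * (Qpoly R k)^`()) \Po bary_arg R) 1
      - simplex_moment (J \Po bary_arg R) ((Qpoly R k)^`() \Po bary_arg R).
Proof.
move=> k4 kev hJ.
have kodd : (-1) ^+ k = 1 :> R by rewrite -signr_odd (negbTE kev).
have k1odd : (-1) ^+ k.-1 = -1 :> R.
  apply: (mulfI (x := -1)); first by rewrite oppr_eq0 oner_eq0.
  by rewrite -exprS prednK ?kodd ?mulrNN ?mulr1//; lia.
have [s0 L01 o0] := legendreP R k; have [s1 L11 o1] := legendreP R k.+1.
set L0 := legendre R k in s0 L01 o0; set L1 := legendre R k.+1 in s1 L11 o1.
pose W : {poly R} := k.+1%:R^-1 *: (L1 - L0).
have QE : Qpoly R k = W^`() by rewrite /Qpoly derivZ.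
have [sJ J1 oJ] := (is_jacobiP _ _ _).1 hJ.
have M1 := jacobi_moment_sign hJ (isT : 1 < 3)%N.
have M2 := jacobi_moment_sign hJ (isT : 2 < 3)%N.
have sW : (size W <= k.+2)%N.
  rewrite (leq_trans (size_scale_leq _ _))// (leq_trans (size_polyD _ _))//.
  by rewrite geq_max size_polyN s0 s1 leqnn leqnSn.
have W2neg : W^`()^`().[-1] < 0.
  have [|c0 c0p e0] := orthogonal_deriv2_m1 (eq_leq s0) o0; first by lia.
  have [|c1 c1p e1] := orthogonal_deriv2_m1 (eq_leq s1) o1; first by lia.
  rewrite !derivZ !derivB hornerZ hornerD hornerN e0 e1 L01 L11.
  rewrite exprS kodd !mulr1 mul1r mulN1r pmulr_rlt0 ?invr_gt0 ?ltr0n//.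
  lra.
have W1pos : 0 < W^`().[1].
  rewrite derivZ derivB hornerZ hornerD hornerN !legendre_deriv1//; last by lia.
  rewrite mulr_gt0 ?invr_gt0 ?ltr0n// subr_gt0 ltr_pM2r ?invr_gt0// ltr_nat.
  by nia.
have W10 : W.[1] = 0 by rewrite hornerZ hornerD hornerN L01 L11 subrr mulr0.
have oW : pint (-1) 1 (J * (W \Po - 'X)) = 0.
  rewrite -pint_reflect comp_polyM comp_reflectK mulrC -scalerAl linearZ/=.
  have sJX : (size (J \Po - 'X) <= k)%N by rewrite size_comp_reflect sJ; lia.
  by rewrite mulrBl linearB/= o0// o1 ?subrr ?mulr0// ltnW.
have sD : (size W^`()^`() <= k.-1.+1)%N.
  apply/leq_sizeP => i ki; rewrite !coef_deriv nth_default ?mul0rn//.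
  by rewrite (leq_trans sW)//; lia.
rewrite QE simplex_moment_bary_arg1 (pint_orthogonal_weight2 hJ sD).
rewrite simplex_moment_bary_arg W10.
rewrite polyC0 subr0 [J * (_ + _)]mulrDr [pint _ _ (_ + _)]linearD/= oW add0r.
rewrite -[J * (_ *: _)]scalerAr [pint _ _ (_ *: _)]linearZ/= [J * (1 + 'X)]mulrC.
rewrite expr1 in M1.
move: M1 M2; rewrite k1odd !mulN1r !oppr_gt0 => M1 M2.
rewrite subr_gt0 (@lt_trans _ _ 0)//.
  by rewrite pmulr_rlt0 ?invr_gt0// pmulr_rlt0.
by rewrite mulr_gt0// nmulr_rgt0.
Qed.

(** * Divergence, and how the elements of a mesh meet *)

Lemma affineD (R : realType) (f : pt R -> R) x y : is_affine f ->
  f (x + y) = f x + (f y - f 0).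
Proof. by move=> [n [d fE]]; rewrite !fE dotDr dot0r; ring. Qed.

Lemma affineZ (R : realType) (f : pt R -> R) (c : R) x : is_affine f ->
  f (c *: x) - f 0 = c * (f x - f 0).
Proof. by move=> [n [d fE]]; rewrite !fE dotZr dot0r; ring. Qed.

Lemma is_derive_affine (R : realType) (f : pt R -> R) (x v : pt R) :
  is_affine f -> is_derive x v f (f v - f 0).
Proof.
move=> af.
have h : (fun h : R => h^-1 *: (f (h *: v + x) - f x)) @ 0^' --> f v - f 0.
  apply: cvg_near_cst; near=> h.
  rewrite [h *: v + x]addrC (affineD _ _ af) addrAC subrr add0r affineZ//.
  rewrite -[LHS]/(_ * _) mulrA mulVf ?mul1r//; near: h; exact: nbhs_dnbhs_neq.
apply: DeriveDef; first by apply/cvg_ex; eexists; exact: h.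
exact: (cvg_lim _ h).
Unshelve. all: by end_near. Qed.

Lemma is_derive_horner_affine (R : realType) (f : pt R -> R) (x v : pt R)
    (p : {poly R}) :
  is_affine f -> is_derive x v (fun y => p.[f y]) (p^`().[f x] * (f v - f 0)).
Proof.
move=> af; have df := is_derive_affine x v af.
elim/poly_ind: p => [|p c IH].
  have -> : (fun y => (0 : {poly R}).[f y]) = cst 0.
    by apply/funext => y; rewrite horner0.
  rewrite deriv0 horner0 mul0r; exact: is_derive_cst.
have -> : (fun y => (p * 'X + c%:P).[f y]) = (fun y => p.[f y]) * f + cst c.
  by apply/funext => y; rewrite !hornerE.
apply: is_derive_eq.
rewrite derivD derivM derivX derivC mulr1 !(hornerD, hornerM, hornerX, horner0).
rewrite /GRing.scale/=; ring.
Qed.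

Lemma is_derive_sum_seq (R : realType) (T : eqType) (s : seq T)
    (F : T -> pt R -> R) (dF : T -> R) (x v : pt R) :
  (forall z, z \in s -> is_derive x v (F z) (dF z)) ->
  is_derive x v (fun y => \sum_(z <- s) F z y) (\sum_(z <- s) dF z).
Proof.
elim: s => [|z s IH] h.
  under eq_fun do rewrite big_nil; rewrite big_nil; exact: is_derive_cst.
under eq_fun do rewrite big_cons; rewrite big_cons.
apply: is_deriveD; first by apply: h; exact: mem_head.
by apply: IH => y ys; apply: h; rewrite inE ys orbT.
Qed.

Lemma divergence_near (R : realType) (v w : pt R -> pt R) (x : pt R) :
  (\forall y \near x, v y = w y) -> divergence v x = divergence w x.
Proof.
move=> vw; apply: eq_bigr => i _; apply: near_eq_derive.
by apply: filterS vw => y ->.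
Qed.

(** Each [f z] has a constant gradient, whose product with [u] is [f z u - f z
    0]. *)
Lemma divergence_ridge_sum (R : realType) (T : eqType) (s : seq T)
    (f : T -> pt R -> R) (q : {poly R}) (u x : pt R) :
  (forall z, z \in s -> is_affine (f z)) ->
  divergence (fun y => ((\sum_(z <- s) q.[f z y]) - 1) *: u) x =
  \sum_(z <- s) q^`().[f z x] * (f z u - f z 0).
Proof.
move=> af.
have dE i : 'D_(delta_mx 0 i) (fun y => (((\sum_(z <- s) q.[f z y]) - 1) *: u) 0 i) x
    = (\sum_(z <- s) q^`().[f z x] * (f z (delta_mx 0 i) - f z 0)) * u 0 i.
  have dS := is_derive_sum_seq (s := s) (fun z zs =>
    is_derive_horner_affine x (delta_mx 0 i) q (af z zs)).
  have -> : (fun y => (((\sum_(z <- s) q.[f z y]) - 1) *: u) 0 i) =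
     ((fun y => \sum_(z <- s) q.[f z y]) - cst 1) * cst (u 0 i).
    by apply/funext => y; rewrite mxE.
  rewrite derive_val /GRing.scale/=; ring.
rewrite /divergence; under eq_bigr do rewrite dE mulr_suml.
rewrite exchange_big/=; apply: eq_big_seq => z zs.
have [n [d fE]] := af z zs.
have -> : f z u - f z 0 = \sum_(i < 3) n 0 i * u 0 i.
  by rewrite !fE dot0r add0r addrK dotE.
rewrite mulr_sumr; apply: eq_bigr => i _; rewrite mulrA; congr (_ * _ * _).
rewrite !fE dot0r add0r addrK dotE (bigD1 i)//= mxE !eqxx mulr1.
by rewrite big1 ?addr0// => j ji; rewrite mxE (negbTE ji) andbF mulr0.
Qed.

(** A common point lies in the hull of the common vertices; these miss some
    vertex of [K'], whose barycentric coordinate then vanishes, so the point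
    is not interior to [K']. *)
Lemma mesh_interior_disjoint (R : realType) (Omega : set (pt R))
    (T : {fset simplex R}) (K K' : simplex R) (x : pt R) :
  conforming_mesh Omega T -> K \in T -> K' \in T -> K != K' ->
  (hull K')° x -> ~ hull K x.
Proof.
move=> [tT _ mT] KT K'T KK' xK' xK.
have tK := tT K KT; have tK' := tT K' K'T.
have : hull (K `&` K')%fset x.
  by rewrite -mT//; split => //; exact: interior_subset.
move=> [a [a0 a1 xE]].
have [K'K|] := boolP (K' `<=` K)%fset.
  move/eqP: KK'; apply; apply/eqP; rewrite eq_sym eqEfcard K'K/=.
  by rewrite tK.1 tK'.1.
move=> /fsubsetPn[z zK' zK].
move: xK'; rewrite interior_hullE// => /(_ z zK').
rewrite xE bary_comb// ?fsubsetIr//.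
by rewrite in_fsetI (negbTE zK)/= ltxx.
Qed.

Lemma hull_vertex (R : realType) (S : simplex R) z : z \in S -> hull S z.
Proof.
move=> zS; exists (fun y => (y == z)%:R); split.
- by move=> y _; rewrite ler0n.
- under eq_bigr do rewrite -[(_ == _)%:R]mul1r.
  exact: (sum_delta (fun=> 1)).
- rewrite (bigD1_seq z)//= eqxx scale1r big1 ?addr0// => y yz.
  by rewrite (negbTE yz) scale0r.
Qed.

(** In a conforming mesh, an edge that lies geometrically in an element is
    spanned by two of its vertices: an endpoint is a vertex of the element it
    comes from, hence cannot be a convex combination of other vertices of that
    element. *)
Lemma edge_patch_sub (R : realType) (Omega : set (pt R))
    (T : {fset simplex R}) (E K : simplex R) :
  conforming_mesh Omega T -> is_edge T E -> edge_patch T E K ->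
  (E `<=` K)%fset.
Proof.
move=> [tT _ mT] [_ [K' K'T /fsubsetP EK']] [KT EK].
have tK' := tT K' K'T.
apply/fsubsetP => z zE.
have : hull (K `&` K')%fset z.
  rewrite -mT//; split; first by apply: EK; exact: hull_vertex.
  by apply: hull_vertex; exact: EK'.
move=> [a [a0 a1 zEq]].
have := (baryP tK' (EK' z zE)).2 z (EK' z zE).
rewrite {2}zEq bary_comb ?EK' ?fsubsetIr//.
rewrite in_fsetI; case: (boolP (z \in K)) => // _ /= /eqP.
by rewrite eqxx eq_sym oner_eq0.
Qed.

Lemma measurable_interior_hull (R : realType) (K : simplex R) :
  is_tetrahedron K -> measurable (@pt_of R @^-1` (hull K)°).
Proof.
move=> tK; have [a [b [c [d KE]]]] := tetra_numbering tK.
rewrite (interior_preimage tK KE).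
exact: (measurable_preimage (measurable_bary_map tK KE)
  (@measurable_simplex3 R)).
Qed.

(** The constant does not depend on the chosen pair of vertices, which is what
    makes integrals for different pairs comparable. *)
Lemma tetra_integral_vol (R : realType) (K : simplex R) (a b : pt R) :
  is_tetrahedron K -> a \in K -> b \in K -> a != b ->
  let C := 6%:R * integral3 (hull K)° (fun=> 1) in
  0 < C /\ forall f g : {poly R},
  (lebesgue3 R).-integrable (@pt_of R @^-1` (hull K)°)
    (fun x => (f.[bary K a (pt_of x)] * g.[bary K b (pt_of x)])%:E) /\
  integral3 (hull K)° (fun x => f.[bary K a x] * g.[bary K b x]) =
  C * simplex_moment f g.
Proof.
move=> tK aK bK ab C.
have [c [d KE]] := tetra_vertices tK aK bK ab.
have [v v0 vE] := tetra_integral tK KE.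
suff -> : C = v by [].
rewrite /C; have := (vE 1 1).2.
have -> : (fun x => (1 : {poly R}).[bary K a x] * (1 : {poly R}).[bary K b x]) = fun=> 1.
  by apply/funext => x; rewrite -polyC1 !hornerC mulr1.
by move=> ->; rewrite simplex_moment11; field.
Qed.

(** Nonzero means finite and positive: the volume is a real number obtained
    from an extended one by a truncation that sends infinity to 0. *)
Lemma volume_neq0 (R : realType) (K : simplex R) :
  is_tetrahedron K -> volume (hull K) != 0.
Proof.
move=> tK; have [a [b [c [d KE]]]] := tetra_numbering tK.
have [v v0 vE] := tetra_pushforward tK KE.
rewrite /volume (hull_preimage tK KE).
set S := (X in bary_map _ _ _ _ @^-1` X).
have -> : lebesgue3 R (bary_map K a b c @^-1` S) =
    leb3 R (bary_map K a b c @^-1` S) by [].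
have m1 := @measurable_fst3 R; have m2 := @measurable_snd3 R.
have m3 : measurable_fun setT (fun x : triple R => x.2 : R) by exact: measurable_snd.
have mle (f g : triple R -> R) : measurable_fun setT f -> measurable_fun setT g ->
    measurable [set x | f x <= g x].
  move=> mf mg; have -> : [set x | f x <= g x] = ~` [set x | g x < f x].
    by apply/seteqP; split => x /=; rewrite leNgt => /negP.
  by apply: measurableC; exact: measurable_lt0.
have mS : measurable S.
  have -> : S = [set x | 0 <= x.1.1] `&` [set x | 0 <= x.1.2] `&`
      [set x | 0 <= x.2] `&` [set x | x.1.1 + x.1.2 + x.2 <= 1].
    apply/seteqP; split => x /=; rewrite /S /=; first by case.
    by case=> -[][].
  apply: measurableI; first apply: measurableI; first apply: measurableI.
  - exact: mle.
  - exact: mle.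
  - exact: mle.
  - apply: mle => //.
    apply: (measurable_funD (f := fun x : triple R => x.1.1 + x.1.2 : R)
      (g := fun x : triple R => x.2 : R)) => //.
    exact: (measurable_funD (f := fun x : triple R => x.1.1 : R)
      (g := fun x : triple R => x.1.2 : R)).
have Spos : (0 < leb3 R S)%E.
  apply: (@lt_le_trans _ _ (leb3 R (@simplex3 R))).
    by rewrite leb3_simplex3 lte_fin invr_gt0.
  apply: le_measure; rewrite ?inE//; first exact: measurable_simplex3.
  by move=> x [/= a0 b0 c0 abc]; rewrite /S/=; split; apply/ltW.
have Sfin : (leb3 R S < +oo)%E.
  apply: (@le_lt_trans _ _ (leb3 R (@cube R))); last by rewrite leb3_cube ltry.
  apply: le_measure; rewrite ?inE//; first exact: measurable_cube.
  move=> [[x y] z] [/= x0 y0 z0 xyz]; rewrite /cube/= /setX/= !in_itv/=.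
  by split; first split; apply/andP; split; lra.
rewrite vE//; move: Spos Sfin; case: (leb3 R S) => // s; rewrite lte_fin => s0 _.
by rewrite /= mulf_neq0// gt_eqF.
Qed.

Lemma integral3_comb4 (R : realType) (D : set (pt R)) (F1 F2 F3 F4 : pt R -> R)
    (a1 a2 a3 a4 : R) : measurable (@pt_of R @^-1` D) ->
  (forall F, [\/ F = F1, F = F2, F = F3 | F = F4] ->
    (lebesgue3 R).-integrable (@pt_of R @^-1` D) (fun x => (F (pt_of x))%:E)) ->
  integral3 D (fun x => a1 * F1 x + a2 * F2 x + a3 * F3 x + a4 * F4 x) =
  a1 * integral3 D F1 + a2 * integral3 D F2 + a3 * integral3 D F3
  + a4 * integral3 D F4.
Proof.
move=> mD iF.
have i1 : (lebesgue3 R).-integrable (@pt_of R @^-1` D) (EFin \o (F1 \o @pt_of R)).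
  by apply: iF; constructor 1.
have i2 : (lebesgue3 R).-integrable (@pt_of R @^-1` D) (EFin \o (F2 \o @pt_of R)).
  by apply: iF; constructor 2.
have i3 : (lebesgue3 R).-integrable (@pt_of R @^-1` D) (EFin \o (F3 \o @pt_of R)).
  by apply: iF; constructor 3.
have i4 : (lebesgue3 R).-integrable (@pt_of R @^-1` D) (EFin \o (F4 \o @pt_of R)).
  by apply: iF; constructor 4.
have iZ c F : (lebesgue3 R).-integrable (@pt_of R @^-1` D) (EFin \o (F \o @pt_of R)) ->
   (lebesgue3 R).-integrable (@pt_of R @^-1` D) (EFin \o (fun x => c * F (pt_of x))).
  by move=> h; exact: (integrableZl mD c h).
have iD (f g : (mR R * mR R * mR R)%type -> R) :
   (lebesgue3 R).-integrable (@pt_of R @^-1` D) (EFin \o f) ->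
   (lebesgue3 R).-integrable (@pt_of R @^-1` D) (EFin \o g) ->
   (lebesgue3 R).-integrable (@pt_of R @^-1` D) (EFin \o (fun x => f x + g x)).
  by move=> h h'; exact: (integrableD mD h h').
rewrite /integral3.
rewrite RintegralD//; [|by apply: (iD); [apply: (iD)|]; apply: iZ|exact: iZ].
rewrite RintegralD//; [|by apply: (iD); apply: iZ|exact: iZ].
rewrite RintegralD//; [|exact: iZ|exact: iZ].
by rewrite !RintegralZl.
Qed.

(** * Pressures and velocities on one element *)

Lemma horner_bary_arg (R : realType) (p : {poly R}) (t : R) :
  (p \Po bary_arg R).[t] = p.[1 - 2%:R * t].
Proof.
rewrite horner_comp /bary_arg !(hornerD, hornerZ, hornerX, hornerC).
by rewrite addrC mulNr.
Qed.

Lemma free_span3 (R : realType) (w : 3.-tuple (pt R)) (u : pt R) : free w ->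
  exists c : 'I_3 -> R, u = \sum_(l < 3) c l *: tnth w l.
Proof.
move=> fw.
have bw : basis_of fullv w.
  by rewrite basisEfree fw subvf/= dimvf /dim/= mul1n size_tuple.
exists (fun l => coord w l u).
rewrite {1}(coord_basis bw (memvf u)); apply: eq_bigr => l _.
by rewrite (tnth_nth 0).
Qed.

Lemma velocity_span_dir (R : realType) k (K : simplex R) (w : 3.-tuple (pt R))
    (u : pt R) : free w -> velocity_span k K w (fun x => B_CR k K x *: u).
Proof.
move=> fw; have [c uE] := free_span3 u fw; exists c; apply/funext => x.
rewrite {1}uE scaler_sumr; apply: eq_bigr => l _.
by rewrite !scalerA mulrC.
Qed.

Lemma divergence_B_CR_out (R : realType) (Omega : set (pt R))
    (T : {fset simplex R}) k (K K' : simplex R) (u x : pt R) :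
  conforming_mesh Omega T -> K \in T -> K' \in T -> K != K' -> (hull K')° x ->
  divergence (fun y => B_CR k K y *: u) x = 0.
Proof.
move=> mT KT K'T KK' xK'.
rewrite (@divergence_near _ _ (fun=> 0)); last first.
  have : \forall y \near x, (hull K')° y.
    exact: (nbhs_interior xK').
  apply: filterS => y yK'; rewrite /B_CR indicE memNset ?mul0r ?scale0r//.
  exact: mesh_interior_disjoint mT KT K'T KK' yK'.
rewrite /divergence big1// => i _.
have -> : (fun=> (0 : pt R) 0 i) = cst (0 : R) :> (pt R -> R).
  by apply/funext => y; rewrite mxE.
exact: derive_cst.
Qed.

(** The gradients of the barycentric coordinates satisfy [grad lambda_e . (z -
    r) = lambda_e(z) - lambda_e(r)], so the direction [z - r] singles out the
    two coordinates of [z] and [r]. *)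
Lemma divergence_B_CR_in (R : realType) k (K : simplex R) (z r x : pt R) :
  is_tetrahedron K -> z \in K -> r \in K -> (hull K)° x ->
  let g := (Qpoly R k)^`() \Po bary_arg R in
  divergence (fun y => B_CR k K y *: (z - r)) x =
  -2%:R * (g.[bary K z x] - g.[bary K r x]).
Proof.
move=> tK zK rK xK g.
pose q := Qpoly R k \Po bary_arg R.
rewrite (@divergence_near _ _
   (fun y => ((\sum_(e <- K) q.[bary K e y]) - 1) *: (z - r))); last first.
  have : \forall y \near x, (hull K)° y by exact: (nbhs_interior xK).
  apply: filterS => y /interior_subset yK; rewrite /B_CR indicE mem_set// mul1r.
  by under eq_bigr do rewrite -horner_bary_arg.
rewrite divergence_ridge_sum => [|e eK]; last by have [] := baryP tK eK.
have qE : q^`() = -2%:R *: g by exact: deriv_bary_arg.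
have -> : \sum_(e <- K) q^`().[bary K e x] * (bary K e (z - r) - bary K e 0) =
   \sum_(e <- K) (q^`().[bary K e x] * (e == z)%:R - q^`().[bary K e x] * (e == r)%:R).
  apply: eq_big_seq => e eK; have [ae ve] := baryP tK eK.
  rewrite -mulrBr [e == z]eq_sym [e == r]eq_sym -!ve// (affineD _ _ ae).
  by rewrite -scaleN1r affineZ//; ring.
rewrite sumrB (sum_delta (fun e => q^`().[bary K e x]))//.
rewrite (sum_delta (fun e => q^`().[bary K e x]))//.
by rewrite qE !hornerZ; ring.
Qed.

Lemma critical_pressure_in (R : realType) (Omega : set (pt R))
    (T : {fset simplex R}) (E : simplex R) k (Ks : seq (simplex R))
    (K : simplex R) :
  conforming_mesh Omega T -> uniq Ks -> [set` Ks] = edge_patch T E ->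
  edge_patch T E K ->
  exists2 c : R, c != 0 & forall e x, (hull K)° x ->
    critical_pressure k Ks e x =
    c * (jacobi R k.-1 0 3 \Po bary_arg R).[bary K e x].
Proof.
move=> mT uKs KsE KE.
have KKs : K \in Ks by have : [set` Ks] K by rewrite KsE.
have KT := KE.1; have tK : is_tetrahedron K by have [h _ _] := mT; exact: h.
have jlt : (index K Ks < size Ks)%N by rewrite index_mem.
exists ((-1) ^+ (index K Ks).+1 / volume (hull K)).
  by rewrite mulf_neq0 ?invr_eq0 ?volume_neq0// signr_eq0.
move=> e x xK; rewrite /critical_pressure (bigD1 (Ordinal jlt))//= nth_index//.
rewrite horner_bary_arg indicE mem_set ?mulr1; last exact: interior_subset.
rewrite big1 ?addr0// => i ij.
have iKs : nth fset0 Ks i \in Ks by apply: mem_nth.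
have iT : nth fset0 Ks i \in T.
  by have : [set` Ks] (nth fset0 Ks i) by []; rewrite KsE => -[].
rewrite indicE memNset ?mulr0 ?mul0r//.
apply: (mesh_interior_disjoint mT iT KT _ xK).
apply/eqP => iK; move/eqP: ij; apply; apply/val_inj => /=.
by rewrite -iK index_uniq.
Qed.

Lemma pairing_div_B_CR (R : realType) (Omega : set (pt R))
    (T : {fset simplex R}) k (K : simplex R) (p : pt R -> R) (u : pt R) :
  conforming_mesh Omega T -> K \in T ->
  pairing_div T p (fun y => B_CR k K y *: u) =
  integral3 (hull K)° (fun x => p x * divergence (fun y => B_CR k K y *: u) x).
Proof.
move=> mT KT; rewrite /pairing_div (bigD1_seq K) ?fset_uniq//= big1_seq ?addr0//.
move=> K' /andP[KK' K'T]; rewrite /integral3.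
under eq_Rintegral => x xK'.
  rewrite (divergence_B_CR_out _ _ mT KT K'T _ (set_mem xK')) 1?eq_sym// mulr0.
  over.
by rewrite /Rintegral integral0_eq.
Qed.

(** * Injectivity *)

(** By symmetry, the two integrals that pair [q] with [z] and [q] with [r]
    agree, so the terms in [cq] cancel. What remains is [cz] times the
    difference of [simplex_moment_gap]. *)
Lemma tetra_integral_eq0 (R : realType) k (K : simplex R) (z q r : pt R)
    (cz cq : R) :
  (4 <= k)%N -> ~~ odd k -> is_tetrahedron K ->
  z \in K -> q \in K -> r \in K -> z != q -> z != r -> q != r ->
  let J := jacobi R k.-1 0 3 \Po bary_arg R in
  let g := (Qpoly R k)^`() \Po bary_arg R in
  integral3 (hull K)° (fun x => (cz * J.[bary K z x] + cq * J.[bary K q x]) *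
     (g.[bary K z x] - g.[bary K r x])) = 0 -> cz = 0.
Proof.
move=> k4 kev tK zK qK rK zq zr qr J g.
have qz : q != z by rewrite eq_sym.
set C := 6%:R * integral3 (hull K)° (fun=> 1).
have [C0 Izr] := tetra_integral_vol tK zK rK zr.
have [_ Iqr] := tetra_integral_vol tK qK rK qr.
have [_ Iqz] := tetra_integral_vol tK qK zK qz.
rewrite -/C in C0 Izr Iqr Iqz.
have -> : (fun x => (cz * J.[bary K z x] + cq * J.[bary K q x]) *
     (g.[bary K z x] - g.[bary K r x])) = (fun x =>
   cz * ((J * g).[bary K z x] * (1 : {poly R}).[bary K r x]) +
   (- cz) * (J.[bary K z x] * g.[bary K r x]) +
   cq * (J.[bary K q x] * g.[bary K z x]) +
   (- cq) * (J.[bary K q x] * g.[bary K r x])).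
  by apply/funext => x; rewrite -polyC1 hornerC hornerM; ring.
rewrite integral3_comb4; first last.
- by move=> F [] ->; [exact: (Izr _ _).1|exact: (Izr _ _).1|
    exact: (Iqz _ _).1|exact: (Iqr _ _).1].
- exact: measurable_interior_hull.
rewrite (Izr _ _).2 (Izr _ _).2 (Iqz _ _).2 (Iqr _ _).2 => /eqP.
have hJ : is_jacobi k.-1 0 3 (jacobi R k.-1 0 3).
  exact: (xgetPex 0 (jacobi_exists R _ 3)).
have := simplex_moment_gap k4 kev hJ; rewrite comp_polyM -/J -/g => gap.
set A := simplex_moment (J * g) 1; set B := simplex_moment J g.
have -> : cz * (C * A) + - cz * (C * B) + cq * (C * B) + - cq * (C * B) =
    cz * (C * (A - B)) by ring.
by rewrite mulf_eq0 (gt_eqF (mulr_gt0 C0 gap)) orbF => /eqP.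
Qed.

Theorem theorem6p1 (R : realType) (Omega : set 'rV[R]_3)
    (T : {fset simplex R}) (k : nat) (E : simplex R)
    (Ks : seq (simplex R)) (K : simplex R) (w : 3.-tuple 'rV[R]_3)
    (hOmega : bounded_polyhedral_domain Omega)
    (hT : conforming_mesh Omega T)
    (hk : (4 <= k)%N) (hkeven : ~~ odd k)
    (hE : critical_edge T E)
    (hKs : patch_numbering Omega T E Ks)
    (hK : edge_patch T E K)
    (hw : free w)
    (p : 'rV[R]_3 -> R)
    (hp : pressure_span k E Ks p)
    (hpv : forall v, velocity_span k K w v -> pairing_div T p v = 0) :
  forall x, p x = 0.
Proof.
have [c pE] := hp; have [eE _] := hE; have [uKs KsE _ _] := hKs.
have KT := hK.1; have tK : is_tetrahedron K by have [h _ _] := hT; exact: h.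
have EK := edge_patch_sub hT eE hK.
have [E2 _] := eE.
have [kap kap0 cpE] := critical_pressure_in k hT uKs KsE hK.
suff c0 z : z \in E -> c z = 0.
  by move=> x; rewrite pE big_seq big1// => z zE; rewrite c0// mul0r.
move=> zE; have zK := fsubsetP EK z zE.
have pz := perm_to_rem zE.
have [q remE] : exists q, rem z E = [:: q].
  have := perm_size pz; rewrite [size E]E2 /=; case: (rem z E) => [//|q [|//]] _.
  by exists q.
rewrite remE in pz.
have qE : q \in E by rewrite (perm_mem pz) !inE eqxx orbT.
have qK := fsubsetP EK q qE.
have zq : z != q by have := fset_uniq E; rewrite (perm_uniq pz)/= inE andbT.
(* [r] is a vertex of [K] off the edge; the test direction is [z - r] *)
have /fsubsetPn[r rK rE] : ~~ (K `<=` E)%fset.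
  by apply/negP => /fsubset_leq_card; rewrite E2 tK.1.
have zr : z != r by apply: contraNneq rE => <-.
have qr : q != r by apply: contraNneq rE => <-.
(* the factor [-2 kap] comes from the chain rule and from the sign and volume in
   the critical pressure *)
suff : -2%:R * kap * c z = 0.
  by move=> /eqP; rewrite !mulf_eq0 oppr_eq0 pnatr_eq0 (negbTE kap0)/= => /eqP.
apply: (@tetra_integral_eq0 R k K z q r _ (-2%:R * kap * c q)) => //.
rewrite -[RHS](hpv _ (velocity_span_dir k K (z - r) hw)).
rewrite (pairing_div_B_CR _ _ _ hT KT).
apply: eq_Rintegral => x /set_mem xK.
rewrite (divergence_B_CR_in _ tK zK rK xK) pE (perm_big _ pz)/=.
by rewrite !big_cons big_nil !cpE//; ring.
Qed.
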